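(* There exists an absolute constant $C>0$ such that the following holds. Let $X=(X_1,\ldots,X_n)$ be a random vector in $\mathbb{R}^n$ whose coordinates $X_i$ are real-valued independent random variables. Assume that each $X_i$ has a density bounded by $K$ almost everywhere. Let $P$ be the orthogonal projection in $\mathbb{R}^n$ onto a $d$-dimensional subspace $E$. Then the density of the random vector $PX$ is bounded by $(CK)^d$ almost everywhere.
   Context: An absolute constant is one not depending on any of the parameters ($n$, $d$, $K$, $P$, the distributions of the $X_i$). The random vector $PX$ takes values in the $d$-dimensional subspace $E$, and its density is understood with respect to $d$-dimensional Lebesgue measure on $E$. *)

(* Defs.v *)
From HB Require Import structures.
From mathcomp Require Import all_boot all_order all_algebra.
From mathcomp Require Import all_classical all_reals all_analysis.
From mathcomp Require Import measurable_realfun.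

Set Implicit Arguments.
Unset Strict Implicit.
Unset Printing Implicit Defensive.

Import Order.TTheory GRing.Theory Num.Theory.
Import numFieldNormedType.Exports.

Local Open Scope classical_set_scope.
Local Open Scope ring_scope.

(* On matrices we put the product sigma-algebra of the entries; on 'cV[R]_n,
   for R : realType, it is the Borel sigma-algebra of R^n. *)
Definition measure_matrix_display : measure_display -> measure_display.
Proof. exact. Qed.

Section measurable_matrix.
Context {d : measure_display} {T : measurableType d} (m n : nat).

Definition entry_preimages : set (set 'M[T]_(m, n)) :=
  [set A | exists i j, exists2 B : set T,
     measurable B & A = (fun M : 'M[T]_(m, n) => M i j) @^-1` B].

Let matrix_set0 : <<s entry_preimages >> set0.
Proof. exact: sigma_algebra0. Qed.

Let matrix_setC A : <<s entry_preimages >> A -> <<s entry_preimages >> (~` A).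
Proof. exact: sigma_algebraC. Qed.

Let matrix_bigcup (F : (set 'M[T]_(m, n))^nat) :
  (forall i, <<s entry_preimages >> (F i)) ->
  <<s entry_preimages >> (\bigcup_i (F i)).
Proof. exact: sigma_algebra_bigcup. Qed.

HB.instance Definition _ := @isMeasurable.Build (measure_matrix_display d)
  'M[T]_(m, n) <<s entry_preimages >> matrix_set0 matrix_setC matrix_bigcup.

Lemma measurable_fun_matrixP (d' : measure_display) (S : measurableType d')
    (f : S -> 'M[T]_(m, n)) :
  measurable_fun setT f <->
  forall i j, measurable_fun setT (fun s => f s i j).
Proof.
split=> [mf i j _ B mB|mf].
  rewrite setTI.
  rewrite (_ : _ @^-1` B = f @^-1` ((fun M : 'M[T]_(m, n) => M i j) @^-1` B))//.
  rewrite -[X in measurable X]setTI; apply: mf => //.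
  by apply: sub_sigma_algebra; exists i, j, B.
apply: (@measurability _ _ _ _ setT f entry_preimages) => //.
move=> _ [_ [i [j [B mB ->]]] <-].
exact: (mf i j measurableT).
Qed.

End measurable_matrix.

Section lebesgue_tuple.
Context {R : realType}.
Local Open Scope ereal_scope.
Local Notation Rm := (measurableTypeR R).

Section cons.
Context (n : nat) (mu : {sigma_finite_measure set (n.-tuple Rm) -> \bar R}).

Let cons_pair (p : Rm * n.-tuple Rm) : n.+1.-tuple Rm := [tuple of p.1 :: p.2].

Let uncons (t : n.+1.-tuple Rm) : Rm * n.-tuple Rm :=
  (thead t, [tuple of behead t]).

Let measurable_cons_pair : measurable_fun setT cons_pair.
Proof. by apply: measurable_cons. Qed.

Let measurable_uncons : measurable_fun setT uncons.
Proof.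
apply/measurable_fun_pairP; split; first exact: measurable_tnth.
exact: measurable_behead.
Qed.

Definition lebesgue_cons : set (n.+1.-tuple Rm) -> \bar R :=
  pushforward (lebesgue_measure \x mu) cons_pair.

Let lebesgue_cons0 : lebesgue_cons set0 = 0.
Proof. by rewrite /lebesgue_cons /pushforward preimage_set0 measure0. Qed.

Let lebesgue_cons_ge0 A : 0 <= lebesgue_cons A.
Proof. exact: measure_ge0. Qed.

Let lebesgue_cons_sigma_additive : semi_sigma_additive lebesgue_cons.
Proof.
exact: measure_semi_sigma_additive.
Qed.

HB.instance Definition _ := isMeasure.Build _ _ _ lebesgue_cons
  lebesgue_cons0 lebesgue_cons_ge0 lebesgue_cons_sigma_additive.

Let lebesgue_cons_sigma_finite : sigma_finite setT lebesgue_cons.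
Proof.
have /sigma_finiteP[F [TF ndF Foo]] := sigma_finiteT (@lebesgue_measure R).
have /sigma_finiteP[G [TG ndG Goo]] := sigma_finiteT mu.
have consK (p : Rm * n.-tuple Rm) : uncons (cons_pair p) = p.
  case: p => x t; rewrite /uncons /cons_pair theadE; congr (_, _).
  exact: val_inj.
exists (fun k => uncons @^-1` (F k `*` G k)).
  apply/esym; rewrite -subTset => t _.
  have [i _ Fi] : (\bigcup_i F i) (uncons t).1 by rewrite -TF.
  have [j _ Gj] : (\bigcup_j G j) (uncons t).2 by rewrite -TG.
  exists (maxn i j) => //; split.
    by move: Fi; exact/subsetPset/ndF/leq_maxl.
  by move: Gj; exact/subsetPset/ndG/leq_maxr.
move=> k; have [mF Fk] := Foo k; have [mG Gk] := Goo k.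
have mFG : measurable (F k `*` G k) by exact: measurableX.
split; first by rewrite -[X in measurable X]setTI; exact: measurable_uncons.
rewrite /lebesgue_cons /pushforward -comp_preimage.
rewrite (_ : _ \o _ = id) ?preimage_id; last exact/funext.
by rewrite product_measure1E// lte_mul_pinfty// ge0_fin_numE.
Qed.

HB.instance Definition _ := Measure_isSigmaFinite.Build _ _ _ lebesgue_cons
  lebesgue_cons_sigma_finite.

End cons.

(* Lebesgue measure on R^n as the n-fold product measure; for n = 0 it is the
   unit mass on the point of R^0. *)
Fixpoint lebesgue_tuple (n : nat) :
    {sigma_finite_measure set (n.-tuple Rm) -> \bar R} :=
  match n with
  | 0%N => [the {sigma_finite_measure set _ -> \bar R} of dirac [tuple]]
  | m.+1 => [the {sigma_finite_measure set _ -> \bar R} of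
               lebesgue_cons (lebesgue_tuple m)]
  end.

End lebesgue_tuple.

Section euclidean.
Context {R : realType} {n : nat}.
Implicit Types (x y : 'cV[R]_n) (E : {vspace 'cV[R]_n}).

Definition dotv x y : R := \sum_i x i 0 * y i 0.

Definition orthogonal_projection E (P : 'M[R]_n) : Prop :=
  forall x, P *m x \in E /\ forall y, y \in E -> dotv (x - P *m x) y = 0.

Definition orthonormal_basis E (b : (\dim E).-tuple 'cV[R]_n) : Prop :=
  basis_of E b /\ forall i j, dotv (tnth b i) (tnth b j) = (i == j)%:R.

(* Lebesgue measure on the subspace E, seen as a measure on R^n carried by E:
   for an orthonormal basis b of E, [lebesgue_subspace b] below is the image of
   Lebesgue measure on R^(dim E) under the isometry c |-> \sum_i c_i b_i onto E.
   By rotation invariance it does not depend on the choice of b. *)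
Definition from_coords d (b : d.-tuple 'cV[R]_n)
    (c : d.-tuple (measurableTypeR R)) : 'cV[R]_n :=
  \sum_(i < d) tnth c i *: tnth b i.

Lemma measurable_from_coords d (b : d.-tuple 'cV[R]_n) :
  measurable_fun setT (from_coords b).
Proof.
apply/measurable_fun_matrixP => i j.
under eq_fun do rewrite summxE.
apply: measurable_sum => k; under eq_fun do rewrite mxE.
apply: measurable_funM => //.
exact: measurable_tnth.
Qed.

HB.instance Definition _ d (b : d.-tuple 'cV[R]_n) :=
  isMeasurableFun.Build _ _ _ _ (from_coords b) (measurable_from_coords b).

Section lebesgue_subspace.
Local Open Scope ereal_scope.
Context (d : nat) (b : d.-tuple 'cV[R]_n).

Definition lebesgue_subspace : set 'cV[R]_n -> \bar R :=
  pushforward (lebesgue_tuple d) (from_coords b).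

Let lebesgue_subspace0 : lebesgue_subspace set0 = 0.
Proof. exact: measure0. Qed.

Let lebesgue_subspace_ge0 A : 0 <= lebesgue_subspace A.
Proof. exact: measure_ge0. Qed.

Let lebesgue_subspace_sigma_additive : semi_sigma_additive lebesgue_subspace.
Proof. exact: measure_semi_sigma_additive. Qed.

HB.instance Definition _ := isMeasure.Build _ _ _ lebesgue_subspace
  lebesgue_subspace0 lebesgue_subspace_ge0 lebesgue_subspace_sigma_additive.

End lebesgue_subspace.

Lemma dotvC x y : dotv x y = dotv y x.
Proof. by apply: eq_bigr => i _; rewrite mulrC. Qed.

Lemma dotvDl x y z : dotv (x + y) z = dotv x z + dotv y z.
Proof. by rewrite -big_split; apply: eq_bigr => i _; rewrite mxE mulrDl. Qed.

Lemma dotvZl a x y : dotv (a *: x) y = a * dotv x y.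
Proof. by rewrite mulr_sumr; apply: eq_bigr => i _; rewrite mxE mulrA. Qed.

Lemma dotv_gt0 x : x != 0 -> 0 < dotv x x.
Proof.
move=> x0; rewrite lt_neqAle sumr_ge0 ?andbT; last first.
  by move=> i _; rewrite -expr2 sqr_ge0.
apply: contra x0; rewrite eq_sym => /eqP xx0; apply/eqP/matrixP => i j.
rewrite (ord1 j) mxE; apply/eqP; rewrite -sqrf_eq0 expr2.
by have /psumr_eq0P := xx0 => ->// k _; rewrite -expr2 sqr_ge0.
Qed.

(* Hence quantifying over all orthonormal bases of E is never vacuous. *)
Lemma orthonormal_basis_exists E : exists b, @orthonormal_basis E b.
Proof.
suff [s [sE sd sO]] : exists s : seq 'cV[R]_n,
    [/\ basis_of E s, size s = \dim E &
      forall i j, (i < size s)%N -> (j < size s)%N ->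
        dotv s`_i s`_j = (i == j)%:R].
  have st : size s == \dim E by rewrite sd.
  exists (Tuple st); split=> // i j; rewrite !(tnth_nth 0)/= sO ?sd//.
elim: {E}(\dim E) {-2}E (erefl (\dim E)) => [|d IH] E dE.
  exists [::]; split=> //; rewrite basisEdim/= dE leqnn andbT.
  by move/eqP: dE; rewrite dimv_eq0 => /eqP->; rewrite sub0v.
have E0 : E != 0%VS by rewrite -dimv_eq0 dE.
set v := vpick E.
have v0 : v != 0 by rewrite vpick0.
have vv : 0 < dotv v v := dotv_gt0 v0.
pose u := (Num.sqrt (dotv v v))^-1 *: v.
have uE : u \in E by rewrite memvZ// memv_pick.
have uu : dotv u u = 1.
  rewrite dotvZl dotvC dotvZl mulrA -expr2 exprVn sqr_sqrtr ?ltW//.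
  by rewrite mulVf// gt_eqF.
have dl : linear (fun x => dotv x u : R^o).
  by move=> a x y; rewrite dotvDl dotvZl.
pose dH := GRing.isLinear.Build _ _ _ _ _ dl.
pose f : {linear 'cV[R]_n -> R^o} := HB.pack (fun x => dotv x u : R^o) dH.
pose E' := (E :&: lker (linfun f))%VS.
have fE x : linfun f x = dotv x u by rewrite lfunE.
have E'P x : (x \in E') = (x \in E) && (dotv x u == 0).
  by rewrite memv_cap memv_ker fE.
have dfE : \dim (linfun f @: E) = 1%N.
  apply/eqP; rewrite eqn_leq; apply/andP; split.
    by apply: leq_trans (dimvS (subvf _)) _; rewrite dimvf.
  rewrite lt0n dimv_eq0; apply/eqP => fE0.
  have := memv_img (linfun f) uE.
  by rewrite fE0 memv0 fE uu oner_eq0.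
have dE' : \dim E' = d.
  by have := limg_ker_dim (linfun f) E; rewrite dfE dE addn1 => -[].
have [s [sE sd sO]] := IH _ dE'.
exists (u :: s); split=> /=.
- rewrite basisEdim/= sd dE' dE leqnn andbT span_cons.
  apply/subvP => x xE.
  have -> : x = dotv x u *: u + (x - dotv x u *: u) by rewrite addrCA subrr addr0.
  apply: memv_add; first by rewrite memvZ// memv_line.
  rewrite (span_basis sE) E'P; apply/andP; split.
    by apply: memvB => //; exact: memvZ.
  by rewrite dotvDl -scaleNr dotvZl uu mulr1 subrr.
- by rewrite sd dE dE'.
- have us k : (k < size s)%N -> dotv s`_k u = 0.
    move=> ks; have := mem_nth 0 ks => /(basis_mem sE).
    by rewrite E'P => /andP[_ /eqP].
  move=> [|i] [|j] //= ilt jlt; first by rewrite dotvC us.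
    by rewrite us.
  by rewrite sO.
Qed.

End euclidean.

Section density.
Context {dT : measure_display} {T : measurableType dT} {R : realType}.
Implicit Types mu nu : set T -> \bar R.

Definition is_density nu mu (f : T -> R) : Prop :=
  [/\ measurable_fun setT f, forall x, 0 <= f x &
      forall A, measurable A -> nu A = (\int[mu]_(x in A) (f x)%:E)%E].

Definition has_density_bounded_by nu mu (M : R) : Prop :=
  exists f : T -> R, is_density nu mu f /\ {ae mu, forall x, f x <= M}.

End density.

Section random_vector.
Context {dT : measure_display} {T : measurableType dT} {R : realType}
  (Pr : probability T R) (n : nat).

Definition independent_RVs (X : 'I_n -> {RV Pr >-> R}) : Prop :=
  forall (J : {set 'I_n}) (B : 'I_n -> set R),
    (forall i, measurable (B i)) ->
    Pr (\bigcap_(i in [set` J]) (X i @^-1` B i)) =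
    (\prod_(i in J) Pr (X i @^-1` B i))%E.

Definition projected (P : 'M[R]_n) (X : 'I_n -> {RV Pr >-> R}) (t : T)
  : 'cV[R]_n := P *m \col_i X i t.

Lemma measurable_projected P X : measurable_fun setT (projected P X).
Proof.
apply/measurable_fun_matrixP => i j.
under eq_fun do rewrite mxE.
apply: measurable_sum => k; under eq_fun do rewrite mxE.
by apply: measurable_funM.
Qed.

HB.instance Definition _ P X :=
  isMeasurableFun.Build _ _ _ _ (projected P X) (measurable_projected P X).

End random_vector.

(* Main.v *)
(* Idea. Write PX in an orthonormal basis of E as AX, where A has orthonormal
   rows, and let Q = 1 - A^T A be the projection onto ker A. With c_i = Q_ii one
   has sum_i (1 - c_i) = d, so bounding f_i by K^(1 - c_i) f_i^(c_i) reduces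
   the theorem to the geometric Brascamp-Lieb inequality on the fibres of A.
   This is proved by Barthe's transport argument. Let S_i transport f_i to a
   centred Gaussian of variance c_i; the map T(x) = A^T A x + Q S(x) preserves
   the fibres, is injective since the S_i are increasing, and has Jacobian
   determinant at least prod_i S_i'(x_i)^(c_i) by the Cauchy-Binet formula and
   the AM-GM inequality, while |Q S|^2 <= |S|^2 compares the Gaussian weights.
   The normalisation costs prod_i c_i^(-c_i/2) <= exp (d/2).
   To use only linear changes of variables, each f_i is replaced by its averages
   over the preimages of a fine grid under S_i, so that T is affine on boxes;
   these averages converge to f_i almost everywhere by Lebesgue's
   differentiation theorem, and Fatou's lemma gives the general case. *)

From HB Require Import structures.
Require Import Defs.
From mathcomp Require Import all_boot all_order all_algebra.
From mathcomp Require Import all_classical all_reals all_analysis.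
From mathcomp Require Import measurable_realfun perm ring lra.

Set Implicit Arguments.
Unset Strict Implicit.
Unset Printing Implicit Defensive.

Import Order.TTheory GRing.Theory Num.Theory.
Import numFieldNormedType.Exports.

Local Open Scope classical_set_scope.
Local Open Scope ring_scope.

(** * Lebesgue measure on column vectors *)

(** Densities on fibres are never handled directly. The goal is turned into a bound between
    measures, P(AX in B) <= (e K)^d |B| for every Borel set B, which the Radon-Nikodym theorem
    converts into a density bounded almost everywhere. For fixed B, the map T is tested against the
    function of y equal to 1_B(A y) times a standard Gaussian in the coordinates H y, where the rows
    of H form an orthonormal basis of ker A. The integral of this function is |B|, and A T = A lets
    1_B pass through T unchanged. As T is affine on each box, injectivity is used only to know that
    the images of distinct boxes are disjoint, so that the pieces add up to at most one integral
    over R^n. The constant is C = e because coordinate i is allowed a loss of exp (1 - c_i), and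
    these multiply up to e^d. This allowance covers both c_i^(-c_i/2) and the case c_i = 0, where
    the Gaussian degenerates. *)

Section leb.
Context {R : realType}.
Local Notation Rm := (measurableTypeR R).
Local Notation mu := (@lebesgue_measure R).

Definition colt n (t : n.-tuple Rm) : 'cV[R]_n := \col_i tnth t i.

Lemma measurable_colt n : measurable_fun setT (@colt n).
Proof.
apply/measurable_fun_matrixP => i j; under eq_fun do rewrite mxE.
exact: measurable_tnth.
Qed.

HB.instance Definition _ n :=
  isMeasurableFun.Build _ _ _ _ (@colt n) (@measurable_colt n).

(** Matrices act on column vectors whereas the product measure lives on tuples, hence this copy of
    Lebesgue measure. *)
Definition leb (n : nat) : set 'cV[R]_n -> \bar R :=
  pushforward (lebesgue_tuple n) (@colt n).

Arguments leb n _ : clear implicits.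

Section leb_measure.
Context (n : nat).
Local Open Scope ereal_scope.

Let leb0 : leb n set0 = 0. Proof. exact: measure0. Qed.

Let leb_ge0 A : 0 <= leb n A. Proof. exact: measure_ge0. Qed.

Let leb_sigma_additive : semi_sigma_additive (leb n).
Proof. exact: measure_semi_sigma_additive. Qed.

HB.instance Definition _ := isMeasure.Build _ _ _ (leb n)
  leb0 leb_ge0 leb_sigma_additive.

End leb_measure.

Definition ccons n (x : R) (v : 'cV[R]_n) : 'cV[R]_n.+1 :=
  col_mx (x%:M : 'M[R]_1) v.

Lemma measurable_fun_entry (m n : nat) (i : 'I_m) (j : 'I_n) :
  measurable_fun setT (fun M : 'M[Rm]_(m, n) => M i j).
Proof. by have /measurable_fun_matrixP := @measurable_id _ 'M[Rm]_(m, n) setT. Qed.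

Lemma measurable_ccons d (S : measurableType d) n (f : S -> R)
    (g : S -> 'cV[R]_n) :
  measurable_fun setT f -> measurable_fun setT g ->
  measurable_fun setT (fun s => ccons (f s) (g s)).
Proof.
move=> mf /measurable_fun_matrixP mg.
apply/measurable_fun_matrixP => i j.
under eq_fun do rewrite mxE.
case: (splitP (i : 'I_(1 + n))) => k _; last exact: mg.
by under eq_fun do rewrite mxE !ord1 mulr1n.
Qed.

Lemma colt_cons n (x : Rm) (t : n.-tuple Rm) :
  colt [tuple of x :: t] = ccons x (colt t).
Proof.
apply/matrixP => i j; rewrite !mxE (tnth_nth 0).
case: (splitP (i : 'I_(1 + n))) => k /= ->; first by rewrite !mxE !ord1.
by rewrite mxE (tnth_nth 0).
Qed.

Lemma ge0_integral_leb n (G : 'cV[R]_n -> \bar R) :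
  measurable_fun setT G -> (forall x, 0 <= G x)%E ->
  (\int[leb n]_x G x = \int[lebesgue_tuple n]_t G (colt t))%E.
Proof.
by move=> mG G0; rewrite ge0_integral_pushforward// preimage_setT.
Qed.

Section cons.
Context (n : nat) (G : 'cV[R]_n.+1 -> \bar R).
Hypotheses (mG : measurable_fun setT G) (G0 : forall x, (0 <= G x)%E).

Let f (p : Rm * n.-tuple Rm) := G (ccons p.1 (colt p.2)).

Let mf : measurable_fun setT f.
Proof.
apply: measurableT_comp => //; apply: measurable_ccons.
  exact: measurable_fst.
by apply: measurableT_comp; [exact: measurable_colt|exact: measurable_snd].
Qed.

Let f0 p : (0 <= f p)%E. Proof. exact: G0. Qed.

Let mGr x : measurable_fun setT (fun v => G (ccons x v)).
Proof. by apply: measurableT_comp => //; exact: measurable_ccons. Qed.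

Let leb_consE0 : (\int[leb n.+1]_x G x =
  \int[mu \x lebesgue_tuple n]_p f p)%E.
Proof.
rewrite ge0_integral_leb//=.
rewrite (ge0_integral_pushforward _ _ _ (f := G \o @colt n.+1))//.
- rewrite preimage_setT; apply: eq_integral => -[x t] _ /=.
  by rewrite colt_cons.
- by apply: measurable_cons.
- by apply: measurableT_comp => //; exact: measurable_colt.
- by move=> t _; exact: G0.
Qed.

Lemma leb_consE : (\int[leb n.+1]_x G x =
  \int[mu]_x \int[leb n]_v G (ccons x v))%E.
Proof.
rewrite leb_consE0 fubini_tonelli1//; apply: eq_integral => x _.
by rewrite ge0_integral_leb.
Qed.

Lemma measurable_leb_inner :
  measurable_fun setT (fun x : Rm => \int[leb n]_v G (ccons x v))%E.
Proof.
have := measurable_fun_fubini_tonelli_F (m2 := lebesgue_tuple n) f mf f0.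
by apply: eq_measurable_fun => x _; rewrite ge0_integral_leb.
Qed.

Lemma measurable_lebesgue_inner :
  measurable_fun setT (fun v => \int[mu]_x G (ccons x v))%E.
Proof.
apply: (measurable_fun_fubini_tonelli_G (m1 := mu)
  (fun p : Rm * 'cV[R]_n => G (ccons p.1 p.2))) => //.
apply: measurableT_comp => //.
by apply: measurable_ccons; [exact: measurable_fst|exact: measurable_snd].
Qed.

(** This order of integration serves the shears that translate the first coordinate by an amount
    depending on the others; [leb_consE] serves those that translate the others. *)
Lemma leb_consE' : (\int[leb n.+1]_x G x =
  \int[leb n]_v \int[mu]_x G (ccons x v))%E.
Proof.
rewrite leb_consE0 fubini_tonelli2// ge0_integral_leb//.
  exact: measurable_lebesgue_inner.
by move=> v; exact: integral_ge0.
Qed.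
End cons.
End leb.
Arguments leb {R} n _.

(** * Linear changes of variables *)

Section change_of_variables.
Context {R : realType}.
Local Notation Rm := (measurableTypeR R).
Local Notation mu := (@lebesgue_measure R).

Lemma measurable_affine (a b : R) :
  measurable_fun setT (fun x : Rm => a * x + b : Rm).
Proof. by apply: measurable_funD => //; exact: measurable_funM. Qed.

Section one_dim.
Variables (a b : R).
Hypothesis a0 : 0 < a.

Let phi (x : Rm) : Rm := a * x + b.

Let mphi : measurable_fun setT phi.
Proof. exact: measurable_affine. Qed.

Let nu : {measure set Rm -> \bar R} :=
  [the measure _ _ of mscale (NngNum (ltW a0)) 
     (measure_function_pushforward__canonical__measure_function_Measure mu mphi)].

(** The scaled image measure gives every interval []l, r]] its length, and Lebesgue measure is the
    only measure that does. *)
Lemma lebesgue_measure_affine (A : set Rm) : measurable A ->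
  (mu A = a%:E * mu (phi @^-1` A))%E.
Proof.
move=> mA; suff -> : mu A = nu A by [].
apply: lebesgue_measure_unique => // _ [[l r] _ <-].
rewrite /nu/= /mscale/= /pushforward.
have -> : phi @^-1` `]l, r] = `](l - b) / a, (r - b) / a]%classic.
  apply/seteqP; split => x /=; rewrite !in_itv/= /phi ltr_pdivrMr// ler_pdivlMr//;
    by rewrite ltrBlDr lerBrDr mulrC.
rewrite !lebesgue_measure_itv/= !lte_fin.
rewrite ltr_pM2r ?invr_gt0// ltrD2r; case: ifPn => _; last by rewrite mule0.
by rewrite -!EFinB -EFinM; congr (_%:E); field; rewrite gt_eqF.
Qed.

Lemma ge0_integral_affine_pos (g : Rm -> \bar R) :
  measurable_fun setT g -> (forall x, 0 <= g x)%E ->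
  (a%:E * \int[mu]_x g (a * x + b)%R = \int[mu]_x g x)%E.
Proof.
move=> mg g0.
have -> : (\int[mu]_x g x = \int[nu]_x g x)%E.
  apply: eq_measure_integral => A mA _.
  exact: lebesgue_measure_affine.
rewrite ge0_integral_mscale//=; congr (_ * _)%E.
by rewrite ge0_integral_pushforward// preimage_setT.
Qed.
End one_dim.

Lemma ge0_integral_affine (a b : R) (g : Rm -> \bar R) : a != 0 ->
  measurable_fun setT g -> (forall x, 0 <= g x)%E ->
  (`|a|%:E * \int[mu]_x g (a * x + b)%R = \int[mu]_x g x)%E.
Proof.
move=> a0 mg g0; have [a_lt0|a_ge0] := ltP a 0; last first.
  by rewrite ger0_norm// ge0_integral_affine_pos// lt_neqAle eq_sym a0.
rewrite ltr0_norm// -[RHS](@ge0_integral_affine_pos (- a) b)//; last first.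
  by rewrite oppr_gt0.
congr (_ * _)%E.
(* A negative slope is reduced to a positive one by the reflection x |-> -x, which preserves
   Lebesgue measure. *)
transitivity (\int[pushforward mu (-%R : _ -> Rm)]_x g (- a * x + b)%R)%E.
  rewrite ge0_integral_pushforward//=.
    by rewrite preimage_setT; apply: eq_integral => x _ /=; rewrite mulrNN.
  by apply: measurableT_comp => //; exact: measurable_affine.
by apply: eq_measure_integral => A mA _; exact: lebesgue_measureN.
Qed.

Lemma ge0_integral_shift (b : R) (g : Rm -> \bar R) :
  measurable_fun setT g -> (forall x, 0 <= g x)%E ->
  (\int[mu]_x g (x + b)%R = \int[mu]_x g x)%E.
Proof.
move=> mg g0; rewrite -(@ge0_integral_affine 1 b g)// ?oner_eq0// normr1 mul1e.
by apply: eq_integral => x _; rewrite mul1r.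
Qed.

Lemma measurable_mulmx (m n : nat) (M : 'M[R]_(m, n)) :
  measurable_fun setT (fun x : 'cV[R]_n => M *m x).
Proof.
apply/measurable_fun_matrixP => i j; under eq_fun do rewrite mxE.
apply: measurable_sum => k; apply: measurable_funM => //.
exact: measurable_fun_entry.
Qed.

Lemma measurable_addmx d (S : measurableType d) (m n : nat)
    (f g : S -> 'M[R]_(m, n)) :
  measurable_fun setT f -> measurable_fun setT g ->
  measurable_fun setT (fun x => f x + g x).
Proof.
move=> /measurable_fun_matrixP mf /measurable_fun_matrixP mg.
apply/measurable_fun_matrixP => i j; under eq_fun do rewrite mxE.
exact: measurable_funD.
Qed.

Lemma leb_shift n (w : 'cV[R]_n) (G : 'cV[R]_n -> \bar R) :
  measurable_fun setT G -> (forall x, 0 <= G x)%E ->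
  (\int[leb n]_x G (x + w)%R = \int[leb n]_x G x)%E.
Proof.
elim: n w G => [|n IH] w G mG G0.
  by apply: eq_integral => x _; rewrite (flatmx0 w) addr0.
have mGw : measurable_fun setT (fun x : 'cV[R]_n.+1 => G (x + w)).
  by apply: measurableT_comp => //; exact: measurable_addmx.
have ccE x v : ccons x v + w = ccons (x + w ord0 0) (v + dsubmx (w : 'cV[R]_(1 + n))).
  apply/matrixP => i j; rewrite !mxE.
  case: (splitP (i : 'I_(1 + n))) => k ik; rewrite !mxE !ord1; last first.
    by congr (_ + w _ _); exact: val_inj.
  by rewrite !mulr1n; congr (_ + w _ _); apply: val_inj; rewrite /= ik ord1.
rewrite (leb_consE mGw (fun x => G0 _)) (leb_consE mG G0).
transitivity (\int[mu]_x (fun y => \int[leb n]_v G (ccons y v)) (x + w ord0 0)%R)%E.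
  apply: eq_integral => x _; under eq_integral do rewrite ccE.
  rewrite (IH _ (fun v => G (ccons (x + w ord0 0) v)))//.
  by apply: measurableT_comp => //; exact: measurable_ccons.
apply: (@ge0_integral_shift _ (fun y => (\int[leb n]_v G (ccons y v))%E)).
  exact: measurable_leb_inner.
by move=> x; exact: integral_ge0.
Qed.

(** The change of variables formula as a predicate on M, so that it can be carried through
    factorisations of M. *)
Definition scales_leb n (M : 'M[R]_n) := forall G : 'cV[R]_n -> \bar R,
  measurable_fun setT G -> (forall x, 0 <= G x)%E ->
  (`|\det M|%:E * \int[leb n]_x G (M *m x)%R = \int[leb n]_x G x)%E.

Lemma scales_leb_mul n (M N : 'M[R]_n) :
  scales_leb M -> scales_leb N -> scales_leb (M *m N).
Proof.
move=> sM sN G mG G0; rewrite det_mulmx normrM EFinM -muleA -[RHS]sM//.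
congr (_ * _)%E; rewrite -(sN (fun x => G (M *m x)))//; last first.
  by apply: measurableT_comp => //; exact: measurable_mulmx.
by congr (_ * _)%E; apply: eq_integral => x _; rewrite mulmxA.
Qed.

Lemma mulmx_ccons n (a : R) (w : 'rV[R]_n) (u : 'cV[R]_n) (D : 'M[R]_n) x v :
  (block_mx a%:M w u D : 'M[R]_(1 + n)) *m ccons x v =
  ccons (a * x + (w *m v) 0 0) (x *: u + D *m v).
Proof.
rewrite /ccons [LHS]mul_block_col -mul_mx_scalar; congr col_mx.
by apply/matrixP => i j; rewrite !ord1 !mxE big_ord1 !mxE !mulr1n.
Qed.

Lemma scales_leb_upper n (w : 'rV[R]_n) :
  scales_leb (block_mx 1%:M w 0 1%:M : 'M[R]_(1 + n)).
Proof.
move=> G mG G0; rewrite det_ublock !det1 mulr1 normr1 mul1e.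
have mGM : measurable_fun setT (fun x : 'cV[R]_n.+1 =>
    G ((block_mx 1%:M w 0 1%:M : 'M[R]_(1 + n)) *m x)).
  by apply: measurableT_comp => //; exact: measurable_mulmx.
rewrite (leb_consE' mGM (fun x => G0 _)) (leb_consE' mG G0).
apply: eq_integral => v _.
rewrite -[RHS](@ge0_integral_shift ((w *m v) 0 0))//.
  by apply: eq_integral => x _; rewrite mulmx_ccons mul1r scaler0 add0r mul1mx.
by apply: measurableT_comp => //; exact: measurable_ccons.
Qed.

Lemma scales_leb_lower n (u : 'cV[R]_n) :
  scales_leb (block_mx 1%:M 0 u 1%:M : 'M[R]_(1 + n)).
Proof.
move=> G mG G0; rewrite det_lblock !det1 mulr1 normr1 mul1e.
have mGM : measurable_fun setT (fun x : 'cV[R]_n.+1 =>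
    G ((block_mx 1%:M 0 u 1%:M : 'M[R]_(1 + n)) *m x)).
  by apply: measurableT_comp => //; exact: measurable_mulmx.
rewrite (leb_consE mGM (fun x => G0 _)) (leb_consE mG G0).
apply: eq_integral => x _.
rewrite -[RHS](@leb_shift _ (x *: u))//.
  apply: eq_integral => v _.
  by rewrite mulmx_ccons mul1r mul0mx mxE addr0 mul1mx addrC.
by apply: measurableT_comp => //; exact: measurable_ccons.
Qed.

Lemma scales_leb_diag n (a : R) (D : 'M[R]_n) : a != 0 ->
  scales_leb D -> scales_leb (block_mx a%:M 0 0 D : 'M[R]_(1 + n)).
Proof.
move=> a0 sD G mG G0; rewrite det_ublock det_scalar1 normrM EFinM.
have mM : measurable_fun setT
    (fun x : 'cV[R]_n.+1 => G ((block_mx a%:M 0 0 D : 'M[R]_(1 + n)) *m x)).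
  by apply: measurableT_comp => //; exact: measurable_mulmx.
have mGr x : measurable_fun setT (fun v => G (ccons x v)).
  by apply: measurableT_comp => //; exact: measurable_ccons.
rewrite (leb_consE mM (fun x => G0 _)) (leb_consE mG G0).
have inner0 x : (0 <= \int[leb n]_v G (ccons x v))%E by exact: integral_ge0.
rewrite -[RHS](ge0_integral_affine 0 a0 (measurable_leb_inner mG G0) inner0).
rewrite -muleA; congr (_ * _)%E; rewrite -ge0_integralZl//; last 2 first.
- exact: (measurable_leb_inner mM).
- by move=> x _; exact: integral_ge0.
apply: eq_integral => x _; rewrite addr0 -[RHS]sD//.
congr (_ * _)%E; apply: eq_integral => v _.
by rewrite mulmx_ccons mul0mx mxE addr0 scaler0 add0r.
Qed.

(** Block Gaussian elimination, by induction on the dimension: with a nonzero corner, M is a lower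
    shear times a block diagonal matrix times an upper shear. A zero corner is first made nonzero by
    an upper shear. *)
Lemma unitmx_scales_leb n (M : 'M[R]_n) : M \in unitmx -> scales_leb M.
Proof.
elim: n M => [|n IH] M.
  move=> _ G mG G0; rewrite (flatmx0 M) det_mx00 normr1 mul1e.
  by apply: eq_integral => x _; rewrite (flatmx0 x) (flatmx0 (_ *m _)).
have pivot (a : R) (w : 'rV[R]_n) (u : 'cV[R]_n) (D : 'M[R]_n) : a != 0 ->
    (block_mx a%:M w u D : 'M[R]_(1 + n)) \in unitmx ->
    scales_leb (block_mx a%:M w u D : 'M[R]_(1 + n)).
  move=> a0.
  (* The lower right block is the Schur complement of the pivot [a], to which the induction
     hypothesis applies. *)
  have -> : block_mx a%:M w u D = block_mx 1%:M 0 (a^-1 *: u) 1%:M *m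
      (block_mx a%:M 0 0 (D - a^-1 *: (u *m w)) *m
       block_mx 1%:M (a^-1 *: w) 0 1%:M).
    rewrite !mulmx_block !(mulmx0, mul0mx, mulmx1, mul1mx, addr0, add0r).
    rewrite !mul_scalar_mx mul_mx_scalar !scalerA mulfV// !scale1r.
    by rewrite -scalemxAl addrC subrK.
  rewrite !unitmx_mul => /and3P[_ + _] => uD.
  apply: scales_leb_mul; first exact: scales_leb_lower.
  apply: scales_leb_mul; last exact: scales_leb_upper.
  apply: scales_leb_diag => //; apply: IH.
  by move: uD; rewrite !unitmxE det_ublock unitrM => /andP[].
suff {M} : forall M : 'M[R]_(1 + n), M \in unitmx -> scales_leb M by exact.
move=> M uM.
have ulE (N : 'M[R]_(1 + n)) : N = block_mx (N 0 0)%:M (ursubmx N) (dlsubmx N) (drsubmx N).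
  rewrite -[LHS]submxK; congr block_mx; rewrite [LHS]mx11_scalar !mxE.
  by congr (N _ _)%:M; exact: val_inj.
have [M00|M00] := eqVneq (M 0 0) 0; last first.
  by rewrite (ulE M); apply: pivot => //; rewrite -ulE.
have [i Mi] : exists i, M i 0 != 0.
  apply/existsP; apply: contraLR uM; rewrite negb_exists => /forallP M0.
  rewrite unitmxE (expand_det_col _ 0) big1 ?unitr0// => i _.
  by move: (M0 i); rewrite negbK => /eqP ->; rewrite mul0r.
have i0 : i != 0 by apply: contraNneq Mi => ->; rewrite M00.
have {i Mi i0} [k Mk] : exists k, dlsubmx (M : 'M[R]_(1 + n)) k 0 != 0.
  case: (unliftP 0 i) i0 Mi => [k ->|->]; last by rewrite eqxx.
  by move=> _ Mk; exists k; rewrite !mxE; congr (M _ _ != 0): Mk; exact: val_inj.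
(* [U w] adds to the first row a row whose first entry is nonzero; that entry becomes the new
   corner. *)
pose w : 'rV[R]_n := delta_mx 0 k.
pose U (w : 'rV[R]_n) : 'M[R]_(1 + n) := block_mx 1%:M w 0 1%:M.
have UK : U (- w) *m U w = 1%:M.
  rewrite /U mulmx_block !(mulmx0, mul0mx, mulmx1, mul1mx, addr0, add0r).
  by rewrite subrr -scalar_mx_block.
have -> : M = U (- w) *m (U w *m M) by rewrite mulmxA UK mul1mx.
apply: scales_leb_mul; first exact: scales_leb_upper.
have : U w *m M \in unitmx.
  by rewrite unitmx_mul uM andbT; have [] := mulmx1_unit UK.
rewrite (ulE (U w *m M)) => /pivot; apply.
rewrite [X in U w *m X]ulE M00 /U mulmx_block.
have -> : (0 : 'I_(1 + n)) = lshift n 0 by exact: val_inj.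
rewrite block_mxEul mul1mx mxE mxE mul0rn add0r mxE (bigD1 k)//= mxE !eqxx mul1r.
rewrite big1 ?addr0// => j /negPf jk.
by rewrite [w _ _]mxE eqxx jk mul0r.
Qed.
End change_of_variables.

(** * Product integrals and the law of the random vector *)

Section leb_products.
Context {R : realType}.
Local Notation Rm := (measurableTypeR R).
Local Notation mu := (@lebesgue_measure R).

(* The library has two copies of the Borel structure of [R], with different
   displays: the one of [R] itself and the one of [measurableTypeR R]. *)
Section borel_copies.

Let mu' : set R -> \bar R := mu.

Let mu'0 : mu' set0 = 0%E. Proof. exact: measure0. Qed.

Let mu'_ge0 A : (0 <= mu' A)%E. Proof. exact: measure_ge0. Qed.

Let mu'_sigma_additive : semi_sigma_additive mu'.
Proof. exact: (@measure_semi_sigma_additive _ _ _ mu). Qed.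

HB.instance Definition _ := isMeasure.Build _ _ _ mu' mu'0 mu'_ge0
  mu'_sigma_additive.

Let idR (x : R) : Rm := x.

Let measurable_idR : measurable_fun setT idR.
Proof. by move=> _ Y mY; rewrite setTI. Qed.

Lemma integral_measurableTypeR (D : set R) (f : R -> \bar R) :
  measurable D -> measurable_fun D (f : Rm -> \bar R) ->
  (forall x, D x -> 0 <= f x)%E ->
  @integral _ R R mu D f = @integral _ Rm R mu D f.
Proof.
move=> mD mf f0; rewrite -[LHS]/(@integral _ R R mu' (idR @^-1` D) (f \o idR)).
rewrite -(ge0_integral_pushforward measurable_idR mu')//.
by move=> x; rewrite inE; exact: f0.
Qed.

End borel_copies.

Lemma ccons0 n x (v : 'cV[R]_n) j : ccons x v ord0 j = x.
Proof.
by rewrite mxE; case: splitP => // k; rewrite !mxE !ord1 mulr1n.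
Qed.

Lemma ccons_lift n x (v : 'cV[R]_n) i j : ccons x v (lift ord0 i) j = v i j.
Proof.
rewrite mxE; case: splitP => [k|k]; first by rewrite ord1.
by move=> [ik]; congr (v _ _); exact: val_inj.
Qed.

Lemma measurable_prod_entries n (g : 'I_n -> R -> R) :
  (forall i, measurable_fun setT (g i : Rm -> R)) ->
  measurable_fun setT (fun x : 'cV[R]_n => \prod_i g i (x i 0)).
Proof.
move=> mg; apply: measurable_prod => i _.
by apply: (measurableT_comp (mg i)); exact: measurable_fun_entry.
Qed.

Lemma leb_prod n (g : 'I_n -> R -> R) :
  (forall i, measurable_fun setT (g i : Rm -> R)) ->
  (forall i x, 0 <= g i x) ->
  (\int[leb n]_x (\prod_i g i (x i ord0))%R%:E =
   \prod_i \int[mu]_x (g i x)%:E)%E.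
Proof.
elim: n g => [|n IH] g mg g0.
  rewrite [RHS]big_ord0 ge0_integral_leb//=; last 2 first.
  - by apply/measurable_EFinP; exact: measurable_prod_entries.
  - by move=> x; rewrite lee_fin prodr_ge0.
  rewrite integral_dirac//= ?diracT ?mul1e ?big_ord0//.
  under eq_fun do rewrite big_ord0; exact: measurable_cst.
rewrite leb_consE; last 2 first.
- by apply/measurable_EFinP; exact: measurable_prod_entries.
- by move=> x; rewrite lee_fin prodr_ge0.
rewrite big_ord_recl -ge0_integralZr//; last 3 first.
- exact/measurable_EFinP.
- by move=> x _; rewrite lee_fin.
- by apply: prode_ge0 => i _; apply: integral_ge0 => x _; rewrite lee_fin.
apply: eq_integral => x _.
under eq_integral do rewrite big_ord_recl ccons0.
rewrite -IH//.
rewrite -ge0_integralZl//; last 3 first.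
- apply/measurable_EFinP.
  by apply: (@measurable_prod_entries n (fun i => g (lift ord0 i))) => i; exact: mg.
- by move=> v _; rewrite lee_fin prodr_ge0.
- by rewrite lee_fin.
apply: eq_integral => v _; rewrite -EFinM; congr (_ * _)%:E.
by apply: eq_bigr => i _; rewrite ccons_lift.
Qed.

Lemma measurable_usubmx d m n :
  measurable_fun setT (fun x : 'M[R]_(d + m, n) => usubmx x).
Proof.
apply/measurable_fun_matrixP => i j; under eq_fun do rewrite mxE.
exact: measurable_fun_entry.
Qed.

Lemma measurable_dsubmx d m n :
  measurable_fun setT (fun x : 'M[R]_(d + m, n) => dsubmx x).
Proof.
apply/measurable_fun_matrixP => i j; under eq_fun do rewrite mxE.
exact: measurable_fun_entry.
Qed.

Lemma leb_split d m (G1 : 'cV[R]_d -> \bar R) (G2 : 'cV[R]_m -> \bar R) :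
  measurable_fun setT G1 -> (forall x, 0 <= G1 x)%E ->
  measurable_fun setT G2 -> (forall x, 0 <= G2 x)%E ->
  (\int[leb (d + m)]_x (G1 (usubmx x) * G2 (dsubmx x)) =
   \int[leb d]_x G1 x * \int[leb m]_x G2 x)%E.
Proof.
move=> + + mG2 G20; elim: d G1 => [|d IH] G1 mG1 G10.
  rewrite [X in (X * _)%E]ge0_integral_leb//= integral_dirac//; last first.
    by apply: measurableT_comp => //; exact: measurable_colt.
  rewrite diracT mul1e -ge0_integralZl//.
  apply: eq_integral => x _; congr (G1 _ * G2 _)%E.
    by rewrite [LHS]flatmx0 [RHS]flatmx0.
  by apply/matrixP => i j; rewrite mxE; congr (x _ _); exact: val_inj.
rewrite [LHS](@leb_consE R (d + m)); last 2 first.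
- apply: (@emeasurable_funM _ _ _ _
      (fun x : 'cV[R]_(d.+1 + m) => G1 (usubmx x)) (fun x => G2 (dsubmx x))).
    by apply: measurableT_comp => //; exact: measurable_usubmx.
  by apply: measurableT_comp => //; exact: measurable_dsubmx.
- by move=> x; rewrite mule_ge0.
rewrite leb_consE// -ge0_integralZr//; last 3 first.
- exact: measurable_leb_inner.
- by move=> x _; exact: integral_ge0.
- exact: integral_ge0.
apply: eq_integral => x _.
rewrite -(IH (fun u => G1 (ccons x u)))//; last first.
  by apply: measurableT_comp => //; exact: measurable_ccons.
apply: eq_integral => v _; congr (G1 _ * G2 _)%E.
  apply/matrixP => i j; rewrite mxE; case: (unliftP ord0 i) => [k|] ->.
    rewrite [RHS]ccons_lift [RHS]mxE -[RHS](ccons_lift x); congr (ccons _ _ _ _).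
    exact: val_inj.
  by rewrite [RHS]ccons0 -[RHS](ccons0 x v j); congr (ccons _ _ _ _); exact: val_inj.
apply/matrixP => i j; rewrite [LHS]mxE [RHS]mxE -[RHS](ccons_lift x).
by congr (ccons _ _ _ _); exact: val_inj.
Qed.

Lemma measurable_box n (B : 'I_n -> set R) :
  (forall i, measurable (B i : set Rm)) ->
  measurable [set x : 'cV[R]_n | forall i, B i (x i ord0)].
Proof.
move=> mB.
rewrite (_ : [set x | _] = \bigcap_(i in [set: 'I_n])
    (fun x : 'cV[R]_n => x i ord0) @^-1` B i); last first.
  by apply/seteqP; split => x /= Bx i; [move=> _|]; exact: Bx.
apply: fin_bigcap_measurable => // i _.
by rewrite -[X in measurable X]setTI; exact: measurable_fun_entry.
Qed.

(** * The joint density of independent coordinates *)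

Section law.
Context {dT : measure_display} {T : measurableType dT} (Pr : probability T R).
Context (n : nat) (X : 'I_n -> {RV Pr >-> R}) (f : 'I_n -> R -> R).
Hypothesis indX : independent_RVs X.
Hypothesis df : forall i,
  is_density (distribution Pr (X i)) (@lebesgue_measure R) (f i).

Definition random_col (t : T) : 'cV[R]_n := \col_i X i t.

Lemma measurable_random_col : measurable_fun setT random_col.
Proof.
apply/measurable_fun_matrixP => i j; under eq_fun do rewrite mxE.
exact: measurable_funPT.
Qed.

HB.instance Definition _ :=
  isMeasurableFun.Build _ _ _ _ random_col measurable_random_col.

Let g (x : 'cV[R]_n) := (\prod_i f i (x i ord0))%:E.

Let mg : measurable_fun setT g.
Proof.
by apply/measurable_EFinP; apply: measurable_prod_entries => i; case: (df i).
Qed.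

Let g0 x : (0 <= g x)%E.
Proof. by rewrite lee_fin prodr_ge0// => i _; case: (df i). Qed.

Let nu (A : set 'cV[R]_n) := (\int[leb n]_(x in A) g x)%E.

Let nu0 : nu set0 = 0%E. Proof. exact: integral_set0. Qed.

Let nu_ge0 A : (0 <= nu A)%E. Proof. exact: integral_ge0. Qed.

Let nu_sigma_additive : semi_sigma_additive nu.
Proof.
move=> F mF tF mUF; rewrite /nu ge0_integral_bigcup//; last first.
  exact: measurable_funTS.
apply: is_cvg_ereal_nneg_natsum_cond => k _ _; exact: integral_ge0.
Qed.

HB.instance Definition _ := isMeasure.Build _ _ _ nu nu0 nu_ge0 nu_sigma_additive.

(** Both sides are measures that agree on boxes, by independence and Tonelli; boxes are stable under
    intersection and generate the sigma-algebra. *)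
Lemma law_density (A : set 'cV[R]_n) : measurable A ->
  Pr (random_col @^-1` A) = (\int[leb n]_(x in A) (\prod_i f i (x i ord0))%:E)%E.
Proof.
pose boxes := [set D : set 'cV[R]_n | exists2 B : 'I_n -> set R,
  (forall i, measurable (B i)) & D = [set x | forall i, B i (x i ord0)]].
move=> mA.
have boxesE : @measurable _ 'cV[R]_n = <<s boxes >>.
  apply/seteqP; split.
    apply: smallest_sub; first exact: smallest_sigma_algebra.
    move=> _ [i [j [B mB ->]]]; apply: sub_sigma_algebra.
    exists (fun k => if k == i then B else setT).
      by move=> k; case: ifP.
    have -> : j = ord0 by exact: ord1.
    apply/seteqP; split => x /=.
      by move=> Bx k; case: eqP => // ->.
    by move=> /(_ i); rewrite eqxx.
  apply: smallest_sub; first exact: sigma_algebra_measurable.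
  by move=> _ [B mB ->]; exact: measurable_box.
apply: (measure_unique boxes (fun=> setT) boxesE _ _ _ (distribution Pr random_col) nu) => //.
- move=> _ _ [B mB ->] [B' mB' ->]; exists (fun i => B i `&` B' i).
    by move=> i; exact: measurableI.
  apply/seteqP; split => x /=; first by move=> [Bx B'x] i; split.
  by move=> BB'; split => i; have [] := BB' i.
- move=> _; exists (fun=> setT) => //.
  by apply/seteqP; split.
- by rewrite bigcup_const.
- move=> _ [B mB ->]; rewrite /distribution/= /pushforward/= /nu.
  transitivity (Pr (\bigcap_(i in [set` [set: 'I_n]%SET]) (X i @^-1` B i))).
    congr (Pr _); apply/seteqP; split => t /=.
      by move=> Bt i _; have := Bt i; rewrite mxE.
    by move=> Bt i; rewrite mxE; apply: Bt => /=; rewrite inE.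
  rewrite indX// integral_mkcond.
  transitivity (\int[leb n]_x (\prod_i (f i (x i ord0) * \1_(B i) (x i ord0)))%:E)%E.
    rewrite (@leb_prod _ (fun i x => f i x * \1_(B i) x)); last 2 first.
    + move=> i; apply: measurable_funM; first by case: (df i).
      by apply: measurable_indic; exact: mB.
    + by move=> i x; rewrite mulr_ge0//; case: (df i).
    under eq_bigl do rewrite inE.
    apply: eq_bigr => i _; have [_ _ /(_ _ (mB i)) dE] := df i.
    rewrite -[LHS]/(distribution Pr (X i) (B i)) dE integral_measurableTypeR//;
      last 2 first.
    + by apply: measurable_funTS; apply/measurable_EFinP; case: (df i).
    + by move=> x _; rewrite lee_fin; case: (df i).
    rewrite [LHS]integral_mkcond.
    apply: eq_integral => x _.
    by rewrite restrict_EFin/= /patch indicE; case: ifP; rewrite ?mulr1 ?mulr0.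
  apply: eq_integral => x _; rewrite /patch; case: ifPn => [|xB].
    rewrite inE/= => xB; congr (_%:E); apply: eq_bigr => i _.
    by rewrite indicE mem_set ?mulr1//; exact: xB.
  have [i xi] : exists i, ~ B i (x i ord0).
    by apply/existsNP => Bx; move: xB; rewrite notin_setE; exact.
  by rewrite (bigD1 i)//= indicE memNset// mulr0 mul0r.
- by move=> _; rewrite (le_lt_trans (probability_le1 _ _)) ?ltry.
Qed.
End law.
End leb_products.

(** * A determinant inequality for orthonormal rows *)

Section frame_determinant.
Context {R : realType}.

Lemma ln_prod (I : Type) (r : seq I) (P : pred I) (F : I -> R) :
  (forall i, P i -> 0 < F i) ->
  ln (\prod_(i <- r | P i) F i) = \sum_(i <- r | P i) ln (F i).
Proof.
move=> F0; elim: r => [|i r IH]; first by rewrite !big_nil ln1.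
rewrite !big_cons; case: ifP => // Pi.
by rewrite lnM ?IH// posrE; [exact: F0|exact: prodr_gt0].
Qed.

Section cauchy_binet.
Context (m n : nat) (H : 'M[R]_(m, n)).

Let minor (f : {ffun 'I_m -> 'I_n}) : 'M[R]_m := \matrix_(k, l) H k (f l).

(* The Cauchy-Binet formula, summed over all maps instead of all subsets of
   columns; hence the division by m!. *)
Definition minor_weight f : R := \det (minor f) ^+ 2 / m`!%:R.

Lemma minor_weight_ge0 f : 0 <= minor_weight f.
Proof. by rewrite divr_ge0 ?sqr_ge0. Qed.

(** A repeated column makes the minor vanish. *)
Lemma minor_weight_inj f : minor_weight f != 0 -> injective f.
Proof.
move=> wf k l fkl; apply: contraNeq wf => kl.
rewrite /minor_weight -det_tr (determinant_alternate kl) ?expr0n ?mul0r//.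
by move=> i; rewrite !mxE fkl.
Qed.

(** Multilinear expansion selects one column for each row and produces one minor ([E1]). Averaging
    over the permutations of the selected columns turns the remaining product of entries into the
    same minor again, hence the square. *)
Lemma det_weighted_gram (t : 'rV[R]_n) :
  \det (H *m diag_mx t *m H^T) =
  \sum_(f : {ffun 'I_m -> 'I_n}) minor_weight f * \prod_k t 0 (f k).
Proof.
have E1 : \det (H *m diag_mx t *m H^T) =
    \sum_(f : {ffun 'I_m -> 'I_n})
      (\prod_k H k (f k)) * (\prod_k t 0 (f k) * \det (minor f)).
  transitivity (\sum_(s : 'S_m) \sum_(f : {ffun 'I_m -> 'I_n})
      (-1) ^+ s * \prod_k (H k (f k) * t 0 (f k) * H (s k) (f k))).
    apply: eq_bigr => s _; rewrite -mulr_sumr; congr (_ * _).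
    rewrite -(bigA_distr_bigA (fun k i => H k i * t 0 i * H (s k) i)).
    apply: eq_bigr => k _; rewrite mxE; apply: eq_bigr => i _.
    by rewrite mul_mx_diag !mxE.
  rewrite exchange_big; apply: eq_bigr => f _ /=.
  rewrite -(det_tr (minor f)) mulrA mulr_sumr; apply: eq_bigr => s _.
  rewrite mulrCA; congr (_ * _); rewrite -!big_split/=.
  by apply: eq_bigr => k _; rewrite !mxE.
(* The average over permutations: multiply by m!, and in the copy indexed by [s] replace [f] by
   [f \o s], which multiplies the minor by the sign of [s]. *)
apply: (mulfI (x := m`!%:R)); first by rewrite pnatr_eq0 -lt0n fact_gt0.
transitivity (\sum_(s : 'S_m) \det (H *m diag_mx t *m H^T)).
  by rewrite sumr_const card_Sn mulr_natl.
transitivity (\sum_(s : 'S_m) \sum_(f : {ffun 'I_m -> 'I_n})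
    (\prod_k H k (f (s k))) * (\prod_k t 0 (f k) * ((-1) ^+ s * \det (minor f)))).
  apply: eq_bigr => s _; rewrite E1.
  pose h (f : {ffun 'I_m -> 'I_n}) : {ffun 'I_m -> 'I_n} := [ffun k => f (s k)].
  pose h' (f : {ffun 'I_m -> 'I_n}) : {ffun 'I_m -> 'I_n} := [ffun k => f (s^-1%g k)].
  rewrite (reindex h)/=; last first.
    exists h' => f _; apply/ffunP => k; rewrite !ffunE.
      by rewrite permKV.
    by rewrite permK.
  apply: eq_bigr => f _; congr (_ * (_ * _)).
  - by apply: eq_bigr => k _; rewrite ffunE.
  - rewrite [RHS](reindex_inj (@perm_inj _ s)).
    by apply: eq_bigr => k _; rewrite ffunE.
  - have -> : minor (h f) = col_perm s (minor f).
      by apply/matrixP => k l; rewrite !mxE ffunE.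
    rewrite col_permE det_mulmx det_perm odd_permV. exact: mulrC.
rewrite exchange_big mulr_sumr; apply: eq_bigr => f _ /=.
rewrite /minor_weight mulrA [m`!%:R * _]mulrC divfK; last first.
  by rewrite pnatr_eq0 -lt0n fact_gt0.
rewrite expr2 -mulrA [X in _ = X * _]/determinant mulr_suml; apply: eq_bigr => s _.
have -> : \prod_k H k (f (s k)) = \prod_k minor f k (s k).
  by apply: eq_bigr => k _; rewrite mxE.
move: (\prod_k minor f k (s k)) (\prod_k t 0 (f k)) ((-1) ^+ s) (\det (minor f)).
by move=> a b c e; ring.
Qed.

End cauchy_binet.

(** Two triangular factorisations of the same block matrix, one through each Schur complement. *)
Lemma det_rank1 m (u : 'cV[R]_m) : \det (1%:M + u *m u^T) = 1 + \sum_k u k 0 ^+ 2.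
Proof.
have E1 : block_mx 1%:M (- u^T) u 1%:M =
    block_mx 1%:M 0 u 1%:M *m block_mx 1%:M (- u^T) 0 (1%:M + u *m u^T).
  rewrite mulmx_block !(mulmx0, mul0mx, mulmx1, mul1mx, addr0, add0r).
  by rewrite mulmxN addrCA addNr addr0.
have E2 : block_mx 1%:M (- u^T) u 1%:M =
    block_mx (1%:M + u^T *m u) (- u^T) 0 1%:M *m block_mx 1%:M 0 u 1%:M.
  rewrite mulmx_block !(mulmx0, mul0mx, mulmx1, mul1mx, addr0, add0r).
  by rewrite mulNmx addrK.
have := congr1 determinant E1; rewrite {}E2.
rewrite !det_mulmx !det_ublock !det_lblock !det1 !mulr1 !mul1r => <-.
rewrite det_mx11 !mxE; congr (_ + _).
by apply: eq_bigr => k _; rewrite mxE expr2.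
Qed.

Section frame.
Context (m n : nat) (H : 'M[R]_(m, n)).
Hypothesis HH : H *m H^T = 1%:M.

Let w := minor_weight H.

(** Cauchy-Binet for D = 1: the weights form a probability distribution on the maps [f]. *)
Let sum_w : \sum_f w f = 1.
Proof.
have := det_weighted_gram H (const_mx 1).
rewrite diag_const_mx mulmx1 HH det1 => ->.
by apply: eq_bigr => f _; rewrite big1 ?mulr1// => k _; rewrite mxE.
Qed.

(* Compare the two expressions of det (H D H^T) for D = 1 + E_ii; only injective
   maps f have a nonzero weight. *)
Let marginal i :
  \sum_f w f * (\sum_k (f k == i)%:R) = \sum_k H k i ^+ 2.
Proof.
apply: (addrI 1).
have -> : \sum_k H k i ^+ 2 = \sum_k col i H k 0 ^+ 2.
  by apply: eq_bigr => k _; rewrite mxE.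
rewrite -det_rank1 -HH.
have -> : H *m H^T + col i H *m (col i H)^T =
    H *m diag_mx (\row_j (1 + (j == i)%:R)) *m H^T.
  apply/matrixP => k l; rewrite mul_mx_diag !mxE big_ord1 !mxE.
  under [RHS]eq_bigr do rewrite !mxE mulrDr mulr1 mulrDl.
  rewrite big_split/=; congr (_ + _); first by apply: eq_bigr => j _; rewrite mxE.
  rewrite (bigD1 i)//= eqxx mulr1 big1 ?addr0// => j /negPf ->.
  by rewrite mulr0 mul0r.
rewrite det_weighted_gram -/w -[X in X + _]sum_w -big_split; apply: eq_bigr => f _ /=.
have [->|wf] := eqVneq (w f) 0; first by rewrite !mul0r addr0.
have finj := minor_weight_inj wf.
rewrite -{1}[w f]mulr1 -mulrDr; congr (_ * _).
under [RHS]eq_bigr do rewrite mxE.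
have [k fk|nk] := pickP (fun k => f k == i); last first.
  by rewrite !big1 ?addr0// => k _; rewrite nk ?addr0.
rewrite (bigD1 k)//= [RHS](bigD1 k)//= fk.
have fj j : j != k -> (f j == i) = false.
  by move=> jk; apply: contra_neqF jk => /eqP fj; apply: finj; rewrite fj (eqP fk).
by rewrite !big1 ?addr0 ?mulr1// => j jk; rewrite fj ?addr0.
Qed.

Lemma det_frame_gt0 (t : 'rV[R]_n) : (forall i, 0 < t 0 i) ->
  0 < \det (H *m diag_mx t *m H^T).
Proof.
move=> t0; rewrite det_weighted_gram -/w.
have wt0 f : 0 <= w f * \prod_k t 0 (f k).
  by rewrite mulr_ge0 ?minor_weight_ge0// prodr_ge0// => k _; exact: ltW.
rewrite lt_neqAle sumr_ge0 ?andbT//; apply/eqP => /esym S0.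
have /eqP := sum_w; rewrite big1 ?(eq_sym 0) ?oner_eq0// => f _.
have /eqP := psumr_eq0P (fun f _ => wt0 f) S0 (i := f) isT.
have p0 : 0 < \prod_k t 0 (f k) by apply: prodr_gt0.
by rewrite mulf_eq0 (gt_eqF p0) orbF => /eqP.
Qed.

(** Cauchy-Binet writes the determinant as a mean of the products of [t 0 (f k)] under the weights.
    Concavity of [ln] bounds its logarithm below by the mean of the logarithms, where [marginal]
    gives the coefficient of each [ln (t 0 i)]. *)
Lemma ln_det_frame (t : 'rV[R]_n) : (forall i, 0 < t 0 i) ->
  \sum_i (\sum_k H k i ^+ 2) * ln (t 0 i) <= ln (\det (H *m diag_mx t *m H^T)).
Proof.
move=> t0; have D0 := det_frame_gt0 t0; move: D0; rewrite det_weighted_gram -/w.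
set S := \sum_f _ => S0.
have tf0 (f : {ffun 'I_m -> 'I_n}) : 0 < \prod_k t 0 (f k).
  by apply: prodr_gt0.
rewrite (_ : \sum_i _ = \sum_f w f * ln (\prod_k t 0 (f k))); last first.
  under eq_bigr do rewrite -marginal mulr_suml.
  rewrite exchange_big; apply: eq_bigr => f _ /=.
  under eq_bigr do rewrite -mulrA mulr_suml.
  rewrite -mulr_sumr; congr (_ * _); rewrite exchange_big/=.
  rewrite ln_prod//; apply: eq_bigr => k _.
  rewrite (bigD1 (f k))//= eqxx mul1r big1 ?addr0// => i /negPf.
  by rewrite eq_sym => ->; rewrite mul0r.
rewrite -subr_le0.
have -> : ln S = \sum_f w f * ln S by rewrite -mulr_suml sum_w mul1r.
rewrite -sumrB.
(* Jensen's inequality through the tangent of [ln] at 1: the bound y - 1, at y = product / S, has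
   mean zero. *)
have E0 : \sum_f w f * ((\prod_k t 0 (f k)) / S - 1) = 0.
  under eq_bigr do rewrite mulrBr mulr1 mulrA.
  by rewrite sumrB sum_w -mulr_suml divff ?subrr// gt_eqF.
rewrite -[leRHS]E0; apply: ler_sum => f _; rewrite -mulrBr ler_wpM2l ?minor_weight_ge0//.
rewrite -ln_div ?posrE//.
have := @le_ln1Dx R ((\prod_k t 0 (f k)) / S - 1).
by rewrite addrCA subrr addr0; apply; rewrite ltrBrDl subrr divr_gt0.
Qed.

End frame.
End frame_determinant.

(** * One-dimensional transport to a Gaussian *)

Section density_cdf.
Context {R : realType}.
Local Notation Rm := (measurableTypeR R).
Local Notation mu := (@lebesgue_measure R).

Definition prob_density (f : R -> R) : Prop :=
  [/\ measurable_fun setT (f : Rm -> R), forall x, 0 <= f x &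
      (\int[mu]_x (f x)%:E = 1)%E].

Definition density_cdf (f : R -> R) (x : R) : R :=
  (\int[mu]_(t in `]-oo, x]) f t)%R.

Context (f : R -> R).
Hypothesis df : prob_density f.

Local Notation F := (density_cdf f).

Let f0 x : 0 <= f x. Proof. by case: df. Qed.

Let mf : measurable_fun setT (f : Rm -> R). Proof. by case: df. Qed.

Let intf : mu.-integrable setT (EFin \o f).
Proof.
apply/integrableP; split; first exact/measurable_EFinP.
under eq_integral do rewrite /= ger0_norm//.
by case: df => _ _ ->; rewrite ltry.
Qed.

Let intfS (A : set Rm) : measurable A -> mu.-integrable A (EFin \o f).
Proof. by move=> mA; apply: integrableS intf. Qed.

Let density_cdfB (x y : R) : x <= y ->
  F y - F x = (\int[mu]_(t in `]x, y]) f t)%R.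
Proof.
move=> xy; rewrite /density_cdf (@Rintegral_itvB _ f -oo%O (BRight y) x)//.
exact: intfS.
Qed.

Lemma density_cdf_le (x y : R) : x <= y -> F x <= F y.
Proof.
by move=> xy; rewrite -subr_ge0 density_cdfB//; exact: Rintegral_ge0.
Qed.

Let mu_itv (x y : R) : x <= y -> fine (mu `]x, y]%classic) = y - x.
Proof.
move=> xy; rewrite lebesgue_measure_itv/= lte_fin.
by move: xy; rewrite le_eqVlt => /predU1P[->|->//]; rewrite ltxx subrr.
Qed.

Lemma density_cdf_diff_le (M x y : R) : x <= y ->
  (forall t, x < t <= y -> f t <= M) -> F y - F x <= M * (y - x).
Proof.
move=> xy fM; rewrite density_cdfB// -mu_itv// -Rintegral_cst//.
apply: le_Rintegral => //; first exact: intfS.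
  apply: measurable_bounded_integrable => //.
    by rewrite /= lebesgue_measure_itv/=; case: ifP; rewrite ltry.
  by exists `|M|; split; [exact: num_real|move=> z Mz t _; exact: ltW].
Qed.

Lemma density_cdf_diff_ge (m x y : R) : x <= y ->
  (forall t, x < t <= y -> m <= f t) -> m * (y - x) <= F y - F x.
Proof.
move=> xy fm; rewrite density_cdfB// -mu_itv// -Rintegral_cst//.
apply: le_Rintegral => //; last exact: intfS.
apply: measurable_bounded_integrable => //.
  by rewrite /= lebesgue_measure_itv/=; case: ifP; rewrite ltry.
by exists `|m|; split; [exact: num_real|move=> z mz t _; exact: ltW].
Qed.

Lemma density_cdf_ge0 x : 0 <= F x.
Proof. exact: Rintegral_ge0. Qed.

Let intT : (\int[mu]_t f t)%R = 1.
Proof. by rewrite /Rintegral; case: df => _ _ ->. Qed.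

Lemma density_cdf_le1 x : F x <= 1.
Proof.
rewrite -intT -subr_ge0 -set_itvNyy (@Rintegral_itvB _ f -oo%O +oo%O x)//.
  exact: Rintegral_ge0.
by rewrite set_itvNyy.
Qed.

Let F_above u : u < 1 -> exists x, u < F x.
Proof.
move=> u1.
have : (\int[mu]_(t in `]-oo, n%:R]) (f t)%:E @[n --> \oo] -->
    \int[mu]_(t in \bigcup_n `]-oo, n%:R]%classic) (f t)%:E)%E.
  apply: ge0_nondecreasing_set_cvg_integral => //.
  - move=> m n mn; apply/subsetPset; apply: subset_itvl.
    by rewrite bnd_simp ler_nat.
  - by move=> n; apply: measurable_funTS; exact/measurable_EFinP.
  - by move=> n x _; rewrite lee_fin.
rewrite (_ : \bigcup_n _ = setT); last first.
  rewrite -subTset => t _; exists (Num.truncn t).+1 => //=.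
  by rewrite in_itv/= ltW// truncnS_gt.
case: df => _ _ -> /fine_cvg /cvgr_gt /(_ u u1) [n _ /(_ n (leqnn n))/= un].
by exists n%:R.
Qed.

Let F_below u : 0 < u -> exists x, F x < u.
Proof.
move=> u0.
have : (\int[mu]_(t in `](- n%:R)%R, +oo[) (f t)%:E @[n --> \oo] -->
    \int[mu]_(t in \bigcup_n `](- n%:R)%R, +oo[%classic) (f t)%:E)%E.
  apply: ge0_nondecreasing_set_cvg_integral => //.
  - move=> m n mn; apply/subsetPset; apply: subset_itvr.
    by rewrite bnd_simp lerN2 ler_nat.
  - by move=> n; apply: measurable_funTS; exact/measurable_EFinP.
  - by move=> n x _; rewrite lee_fin.
rewrite (_ : \bigcup_n _ = setT); last first.
  rewrite -subTset => t _; exists (Num.truncn (- t)).+1 => //=.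
  by rewrite in_itv/= andbT ltrNl truncnS_gt.
have u1 : 1 - u < 1 by rewrite ltrBlDr ltrDl.
case: df => _ _ -> /fine_cvg /cvgr_gt /(_ _ u1) [n _ /(_ n (leqnn n))/= un].
exists (- n%:R).
have := @Rintegral_itvB _ f -oo%O +oo%O (- n%:R).
rewrite set_itvNyy intT => /(_ intf isT isT) E.
by rewrite -/(Rintegral _ _ _) -E ltrD2l ltrN2 in un.
Qed.

(** A bounded density has a Lipschitz, hence continuous, distribution function, and the intermediate
    value theorem applies. *)
Lemma density_cdf_surj (M : R) u : (forall t, f t <= M) -> 0 < u < 1 ->
  exists x, F x = u.
Proof.
move=> fM /andP[u0 u1].
have [b ub] := F_above u1; have [a au] := F_below u0.
have ab : a <= b.
  by rewrite leNgt; apply/negP => /ltW /density_cdf_le; rewrite leNgt (lt_trans au ub).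
have M0 : 0 <= M by rewrite (le_trans (f0 0) (fM 0)).
have cF : continuous F.
  move=> x; apply/cvgrPdist_le => e e0.
  have d0 : 0 < e / (M + 1) by rewrite divr_gt0// ltr_wpDl.
  near=> y.
  have yx : `|x - y| <= e / (M + 1).
    by near: y; exact: cvgr_dist_le.
  apply: (@le_trans _ _ (M * `|x - y|)); last first.
    move: yx; rewrite ler_pdivlMr ?ltr_wpDl//; apply: le_trans.
    by rewrite mulrC ler_wpM2l// lerDl.
  have [xy|/ltW xy] := leP x y.
    rewrite distrC [X in _ * X]distrC !ger0_norm ?subr_ge0 ?density_cdf_le//.
    exact: density_cdf_diff_le.
  rewrite !ger0_norm ?subr_ge0 ?density_cdf_le//.
  exact: density_cdf_diff_le.
have [] := @IVT R F a b u ab.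
- exact: continuous_subspaceT.
- by rewrite ge_min le_max (ltW au) (ltW ub) orbT.
by move=> x _ Fx; exists x.
Unshelve. all: by end_near. Qed.

(** Lebesgue differentiation, kept only as a lower bound for increments on both sides of x: the
    averages of f over small cells around x need to be bounded from below only. *)
Lemma density_cdf_derive : {ae mu, forall x, 0 < f x ->
  forall th, th < 1 -> exists2 r, 0 < r & forall y, `|y - x| < r ->
    (x <= y -> th * f x * (y - x) <= F y - F x) /\
    (y <= x -> th * f x * (x - y) <= F x - F y)}.
Proof.
have locf : locally_integrable [set: R] f.
  by apply: open_integrable_locally => //; exact: openT.
have := FTC1Ny (fun y => intfS (measurable_itv `]-oo, y])) locf.
apply: filterS; first exact: (ae_filter_ringOfSetsType mu).
move=> x [dF F'] fx th th1.
have : (h^-1 *: ((F \o shift x) (h *: (1 : R)) - F x)) @[h --> (0 : R)^'] --> f x.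
  by rewrite -F' derive1E; exact: dF.
have e0 : 0 < (1 - th) * f x by rewrite mulr_gt0// subr_gt0.
move/cvgrPdist_le => /(_ _ e0); rewrite near_withinE => /nbhs_ballP[r /= r0 Fr].
exists r => // y yx; have [<-|xy] := eqVneq x y; first by rewrite !subrr !mulr0.
have := Fr (y - x); rewrite /ball/= sub0r normrN => /(_ yx).
rewrite subr_eq0 eq_sym => /(_ xy); rewrite scaler1/= subrK.
rewrite ler_distlC => /andP[+ _]; rewrite mulrBl mul1r opprB addrCA subrr addr0.
rewrite mulrC => Fth; split => le_xy.
  have yx0 : 0 < y - x by rewrite subr_gt0 lt_neqAle xy.
  by rewrite -ler_pdivlMr// [leRHS]mulrC.
have yx0 : 0 < x - y by rewrite subr_gt0 lt_neqAle eq_sym xy.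
by rewrite -ler_pdivlMr// [leRHS]mulrC -[leRHS]mulrNN opprB -invrN opprB.
Qed.
End density_cdf.

(** * Preimages of a fine grid under the monotone transport *)

Section quantile_cells.
Context {R : realType}.
Local Notation mu := (@lebesgue_measure R).
Variables (F G q : R -> R) (M : R).
Hypothesis F_ndecr : forall x y, x <= y -> F x <= F y.
Hypothesis F01 : forall x, 0 <= F x <= 1.
Hypothesis G_incr : forall x y, x < y -> G x < G y.
Hypothesis G_lip : forall x y, x <= y -> G y - G x <= M * (y - x).
Hypothesis G_surj : forall u, 0 < u < 1 -> exists x, G x = u.
Hypothesis FqG : forall x, F (q x) = G x.

(** The grid covers [-(l+1), l+1] with step (l+1)^-2, hence 2 (l+1)^3 cells. The step is that small
    so that x^2 varies by at most 2/(l+1) on every cell, even at the ends. *)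
Definition grid_step (l : nat) : R := (l.+1%:R ^+ 2)^-1.

Definition grid (l j : nat) : R := - l.+1%:R + j%:R * grid_step l.

Definition grid_size (l : nat) : nat := 2 * l.+1 ^ 3.

(** As [F (q x) = G x], the numerator is also the increment of F over the cell; when F is the
    distribution function of f, this is the average of f there. *)
Definition cell_average (l j : nat) : R :=
  (G (grid l j.+1) - G (grid l j)) / (q (grid l j.+1) - q (grid l j)).

Definition cell_slope (l j : nat) : R :=
  grid_step l / (q (grid l j.+1) - q (grid l j)).

Lemma grid_step_gt0 l : 0 < grid_step l.
Proof. by rewrite invr_gt0 exprn_gt0. Qed.

Lemma grid_stepM l : grid_step l * (l.+1%:R *+ 2) = l.+1%:R^-1 *+ 2.
Proof.
rewrite /grid_step mulrnAr; congr (_ *+ 2).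
by rewrite expr2 invfM -mulrA mulVf ?mulr1// pnatr_eq0.
Qed.

Lemma gridS l j : grid l j.+1 = grid l j + grid_step l.
Proof. by rewrite /grid -[j.+1%:R]natr1 mulrDl mul1r addrA. Qed.

Lemma grid_incr l i j : (i < j)%N -> grid l i < grid l j.
Proof.
by move=> ij; rewrite /grid ltrD2l ltr_pM2r ?grid_step_gt0// ltr_nat.
Qed.

Lemma grid_sizeE l :
  (grid_size l)%:R = (l.+1%:R + l.+1%:R) * l.+1%:R ^+ 2 :> R.
Proof. by rewrite natrM natrX; ring. Qed.

Lemma grid_bound l j : (j <= grid_size l)%N -> `|grid l j| <= l.+1%:R.
Proof.
move=> jN; rewrite ler_norml; apply/andP; split.
  by rewrite lerDl mulr_ge0// ltW ?grid_step_gt0.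
rewrite /grid addrC lerBlDr /grid_step ler_pdivrMr ?exprn_gt0//.
by rewrite -grid_sizeE ler_nat.
Qed.

(** F may have plateaus and [q] is just a chosen right inverse; its strict monotonicity is inherited
    from G. *)
Lemma quantile_incr x y : x < y -> q x < q y.
Proof.
move=> /G_incr; rewrite -!FqG; rewrite ltNge [in X in _ -> X]ltNge.
by apply: contra => /F_ndecr.
Qed.

Lemma cell_length_gt0 l j : 0 < q (grid l j.+1) - q (grid l j).
Proof. by rewrite subr_gt0; apply: quantile_incr; exact: grid_incr. Qed.

Lemma cell_average_gt0 l j : 0 < cell_average l j.
Proof.
rewrite divr_gt0 ?cell_length_gt0// subr_gt0; apply: G_incr.
exact: grid_incr.
Qed.

Lemma cell_slope_gt0 l j : 0 < cell_slope l j.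
Proof. by rewrite divr_gt0 ?cell_length_gt0 ?grid_step_gt0. Qed.

(** Let G y = F x. For large l the grid cell of y has G-mass below [g], while F gains at least [g]
    over r/2 on either side of x; so the preimage cell stays within r/2 of x, where the growth bound
    gives an average of at least v. *)
Lemma cells_near (x v r : R) : 0 < v -> 0 < r ->
  (forall y, `|y - x| < r ->
    (x <= y -> v * (y - x) <= F y - F x) /\
    (y <= x -> v * (x - y) <= F x - F y)) ->
  \forall l \near \oo, exists j, [/\ (j < grid_size l)%N,
    q (grid l j) <= x < q (grid l j.+1) & v <= cell_average l j].
Proof.
move=> v0 r0 Fv; pose g := v * (r / 2).
have g0 : 0 < g by rewrite mulr_gt0// divr_gt0.
have Fr : g <= F (x + r / 2) - F x.
  have [|+ _] := Fv (x + r / 2).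
    by rewrite addrAC subrr add0r ger0_norm; lra.
  by rewrite addrAC subrr add0r; apply; lra.
have Fl : g <= F x - F (x - r / 2).
  have [|_] := Fv (x - r / 2).
    by rewrite addrAC subrr add0r normrN ger0_norm; lra.
  by rewrite opprB addrCA subrr addr0; apply; lra.
(* F x lies strictly between 0 and 1, since F increases on both sides of x. *)
have [y Gy] : exists y, G y = F x.
  by apply: G_surj; have := F01 (x + r / 2); have := F01 (x - r / 2); lra.
near=> l.
have L0 : 0 < l.+1%:R :> R by [].
have yL : `|y| < l.+1%:R.
  have yl : `|y| < l%:R by near: l; exact: nbhs_infty_gtr.
  by rewrite -natr1 (lt_trans yl)// ltrDl.
have Mg : M * grid_step l < g.
  have : `|M| / g < l%:R by near: l; exact: nbhs_infty_gtr.
  rewrite ltr_pdivrMr// => Mg.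
  rewrite /grid_step ltr_pdivrMr ?exprn_gt0//.
  apply: (le_lt_trans (ler_norm M)); apply: (lt_le_trans Mg).
  rewrite mulrC ler_pM2l// -natrX ler_nat.
  by rewrite (leq_trans (leqnSn l))// -[X in (X <= _)%N]expn1 leq_pexp2l.
have yL2 : 0 <= (y + l.+1%:R) * l.+1%:R ^+ 2.
  by move: yL; rewrite ltr_norml => yL; rewrite mulr_ge0 ?exprn_ge0//; lra.
pose j := Num.truncn ((y + l.+1%:R) * l.+1%:R ^+ 2).
have /andP[j1 j2] : j%:R <= (y + l.+1%:R) * l.+1%:R ^+ 2 < j.+1%:R by exact: truncn_itv.
have yj1 : grid l j <= y.
  by rewrite /grid addrC lerBlDr /grid_step ler_pdivrMr// exprn_gt0.
have yj2 : y < grid l j.+1.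
  by rewrite /grid addrC ltrBrDr /grid_step ltr_pdivlMr// exprn_gt0.
have jN : (j < grid_size l)%N.
  rewrite -(ltr_nat R) (le_lt_trans j1)// grid_sizeE.
  by rewrite ltr_pM2r ?exprn_gt0//; move: yL; rewrite ltr_norml; lra.
have Gj := G_lip (ltW (grid_incr l (ltnSn j))).
rewrite gridS [X in M * X]addrAC subrr add0r -gridS in Gj.
have Gj1 : G (grid l j) <= F x.
  rewrite -Gy; move: yj1; rewrite le_eqVlt => /predU1P[->//|].
  by move/G_incr/ltW.
have Gj2 : F x < G (grid l j.+1) by rewrite -Gy; exact: G_incr.
have qr : q (grid l j.+1) < x + r / 2.
  rewrite ltNge; apply/negP => /F_ndecr; rewrite FqG; lra.
have ql : x - r / 2 < q (grid l j).
  rewrite ltNge; apply/negP => /F_ndecr; rewrite FqG; lra.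
have qlr := quantile_incr (grid_incr l (ltnSn j)).
have xq2 : x < q (grid l j.+1).
  rewrite ltNge; apply/negP => /F_ndecr; rewrite FqG; lra.
(* Comparing values of F is not enough for a weak inequality; the linear growth of F to the right of
   x excludes a plateau. *)
have xq1 : q (grid l j) <= x.
  rewrite leNgt; apply/negP => xq.
  have [|/(_ (ltW xq)) + _] := Fv (q (grid l j)).
    by rewrite ger0_norm ?subr_ge0; lra.
  rewrite FqG => vG; have : 0 < v * (q (grid l j) - x).
    by rewrite mulr_gt0// subr_gt0.
  lra.
exists j; split => //; first by rewrite xq1.
rewrite /cell_average ler_pdivlMr ?cell_length_gt0// -!FqG.
have [|/(_ (ltW xq2)) F2 _] := Fv (q (grid l j.+1)).
  by rewrite ger0_norm ?subr_ge0; lra.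
have [|_ /(_ xq1) F1] := Fv (q (grid l j)).
  by rewrite distrC ger0_norm ?subr_ge0; lra.
lra.
Unshelve. all: by end_near. Qed.

End quantile_cells.

(** * Gaussian estimates on the cells *)

Section gaussian_steps.
Context {R : realType}.
Local Notation Rm := (measurableTypeR R).
Local Notation mu := (@lebesgue_measure R).

Section normal.
Variable s : R.
Hypothesis s0 : s != 0.

Lemma prob_density_normal : prob_density (normal_pdf 0 s).
Proof.
split; [exact: measurable_normal_pdf|exact: normal_pdf_ge0|].
exact: integral_normal_pdf.
Qed.

Lemma normal_pdf0E x :
  normal_pdf 0 s x = normal_peak s * expR (- x ^+ 2 / (s ^+ 2 *+ 2)).
Proof. by rewrite normal_pdfE// /normal_fun subr0. Qed.

Lemma normal_pdf_sqr_le x y : y ^+ 2 <= x ^+ 2 ->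
  normal_pdf 0 s x <= normal_pdf 0 s y.
Proof.
move=> yx; rewrite !normal_pdf0E ler_pM2l ?normal_peak_gt0// ler_expR.
by rewrite ler_pM2r ?lerN2// invr_gt0 pmulrn_lgt0// exprn_even_gt0.
Qed.

Let Gam := density_cdf (normal_pdf 0 s).

Lemma normal_cdf_incr x y : x < y -> Gam x < Gam y.
Proof.
(* Between x and y the absolute value is at most [z], so the density there is at least its positive
   value at [z]. *)
move=> xy; rewrite -subr_gt0; pose z := `|x| + `|y|.
apply: (@lt_le_trans _ _ (normal_pdf 0 s z * (y - x))).
  by rewrite mulr_gt0 ?subr_gt0// normal_pdf0E mulr_gt0 ?expR_gt0 ?normal_peak_gt0.
apply: (density_cdf_diff_ge prob_density_normal (ltW xy)) => t /andP[xt ty].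
apply: normal_pdf_sqr_le; rewrite -real_normK ?num_real//.
rewrite ler_sqr ?nnegrE ?addr_ge0// /z.
have := ler_norm y; have := ler_norm (- x); rewrite normrN.
have := normr_ge0 x; have := normr_ge0 y.
by case: (ler0P t); lra.
Qed.

Lemma normal_cdf_lip x y : x <= y -> Gam y - Gam x <= normal_peak s * (y - x).
Proof.
move=> xy; apply: density_cdf_diff_le => //; first exact: prob_density_normal.
by move=> t _; exact: normal_pdf_ub.
Qed.

Lemma normal_cdf_surj u : 0 < u < 1 -> exists x, Gam x = u.
Proof.
move=> u01; apply: (density_cdf_surj prob_density_normal (M := normal_peak s)) => //.
by move=> t; exact: normal_pdf_ub.
Qed.

Lemma normal_cdf01 x : 0 < Gam x < 1.
Proof.
have xl : x - 1 < x by rewrite ltrBlDr ltrDl.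
have xr : x < x + 1 by rewrite ltrDl.
rewrite (le_lt_trans _ (normal_cdf_incr xl))//=; last first.
  exact: density_cdf_ge0 prob_density_normal _.
rewrite (lt_le_trans (normal_cdf_incr xr))//.
exact: density_cdf_le1 prob_density_normal _.
Qed.

Lemma ln_normal_peak : ln (normal_peak s) = ln (normal_peak 1) - ln `|s|.
Proof.
rewrite /normal_peak expr1n mul1r -mulrnAr sqrtrM ?sqr_ge0// sqrtr_sqr.
have p0 : 0 < Num.sqrt (pi *+ 2 : R).
  by rewrite sqrtr_gt0 pmulrn_lgt0// pi_gt0.
rewrite invfM lnM ?posrE ?invr_gt0 ?normr_gt0// lnV ?posrE ?normr_gt0//.
by rewrite addrC.
Qed.

End normal.

Section steps.
Variables (f : R -> R) (K c : R).
Hypothesis df : prob_density f.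
Hypothesis fK : forall x, f x <= K.
Hypothesis K0 : 0 < K.
Hypothesis c01 : 0 <= c <= 1.

(* Here [c] plays the role of c_i: the affine maps [s l j * x + t l j] carry the
   cells [q l j, q l j.+1[ onto the cells of a grid, as the monotone transport
   of [f] to the Gaussian of variance [c] does, and [a l j] is, up to a factor
   tending to 1, the average of [f] over the cell. If [c = 0], any increasing
   map with values in [-1, 1] will do, and the grid is scaled accordingly. *)
Lemma gaussian_steps : exists q a s t : nat -> nat -> R,
  [/\ forall l i j, (i < j)%N -> q l i < q l j,
      forall l j, 0 < a l j /\ 0 < s l j,
      forall l i j x y, q l i <= x < q l i.+1 -> q l j <= y < q l j.+1 ->
        x < y -> s l i * x + t l i < s l j * y + t l j,
      forall l j x, (j < grid_size l)%N -> q l j <= x < q l j.+1 ->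
        ln (a l j) + (s l j * x + t l j) ^+ 2 / 2 <=
        (1 - c) * (ln K + 1) + c * (ln (s l j) + ln (normal_peak 1)) &
      {ae mu, forall x, 0 < f x -> forall th, 0 < th < 1 ->
        \forall l \near \oo, exists j, [/\ (j < grid_size l)%N,
          q l j <= x < q l j.+1 & th * f x <= a l j]}].
Proof.
(* The standard deviation of the target; for c = 0 a unit Gaussian is used instead. *)
pose sg : R := if c == 0 then 1 else Num.sqrt c.
have sg0 : sg != 0.
  rewrite /sg; case: (eqVneq c 0) => [_|c0]; first by rewrite oner_eq0.
  by rewrite sqrtr_eq0 -ltNge lt_neqAle eq_sym c0; case/andP: c01.
pose Gam := density_cdf (normal_pdf 0 sg); pose F := density_cdf f.
have [q FqG] : {q : R -> R & forall x, F (q x) = Gam x}.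
  apply: (@boolp.choice _ _ (fun x y => F y = Gam x)) => x.
  apply: (density_cdf_surj df fK).
  exact: normal_cdf01.
have F_ndecr x y : x <= y -> F x <= F y by exact: density_cdf_le.
have F01 x : 0 <= F x <= 1.
  by rewrite (density_cdf_ge0 df) (density_cdf_le1 df).
have Gi x y : x < y -> Gam x < Gam y by exact: normal_cdf_incr.
(* For c = 0 this contracts the grid into [-1, 1], so the quadratic term costs at most 1/2. *)
pose eta (l : nat) : R := if c == 0 then l.+1%:R^-1 else 1.
have eta0 l : 0 < eta l by rewrite /eta; case: ifP => // _; rewrite invr_gt0.
pose a := cell_average Gam q; pose sl := cell_slope q.
have a0 l j : 0 < a l j by exact: (cell_average_gt0 F_ndecr).
have sl0 l j : 0 < sl l j by exact: (cell_slope_gt0 F_ndecr Gi).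
have len0 l j := cell_length_gt0 F_ndecr Gi FqG l j.
pose T l j x := grid l j + sl l j * (x - q (grid l j)).
have T_itv l j x : q (grid l j) <= x < q (grid l j.+1) ->
    grid l j <= T l j x < grid l j.+1.
  move=> /andP[x1 x2]; rewrite /T lerDl mulr_ge0 ?subr_ge0 ?(ltW (sl0 _ _))//=.
  rewrite gridS ltrD2l /sl /cell_slope mulrAC ltr_pdivrMr//.
  by rewrite ltr_pM2l ?grid_step_gt0// ltrD2r.
(* The exponent x^2 / (2 c) varies by at most 1 / (c (l+1)) on a cell; after weighting by c, the
   factor [expR (- dl l)] pays for this error exactly. *)
pose dl (l : nat) : R := l.+1%:R^-1.
exists (fun l j => q (grid l j)), (fun l j => a l j * expR (- dl l)), (fun l j => eta l * sl l j),
  (fun l j => eta l * (grid l j - sl l j * q (grid l j))).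
have SE l j x : eta l * sl l j * x + eta l * (grid l j - sl l j * q (grid l j)) =
    eta l * T l j x by rewrite /T; ring.
split.
- by move=> l i j ij; apply: (quantile_incr F_ndecr Gi FqG); exact: grid_incr.
- by move=> l j; split; apply: mulr_gt0 => //; exact: expR_gt0.
- move=> l i j x y xi yj xy; rewrite !SE ltr_pM2l//.
  have [ij|ji|ij] := ltngtP i j.
  + have /andP[_ T1] := T_itv _ _ _ xi; have /andP[T2 _] := T_itv _ _ _ yj.
    apply: (lt_le_trans T1); apply: (le_trans _ T2).
    by move: ij; rewrite leq_eqVlt => /predU1P[->//|/grid_incr/ltW].
  + have : q (grid l j.+1) <= q (grid l i).
      move: ji; rewrite leq_eqVlt => /predU1P[->//|ji].
      by apply/ltW/(quantile_incr F_ndecr Gi FqG)/grid_incr.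
    by move: xi yj => /andP[? _] /andP[_ ?]; lra.
  + by rewrite ij /T ltrD2l ltr_pM2l// ltrD2r.
- move=> l j x jN xj; rewrite SE lnM ?posrE ?expR_gt0// expRK.
  suff : ln (a l j) + (eta l * T l j x) ^+ 2 / 2 <= (1 - c) * (ln K + 1) + dl l +
      c * (ln (eta l * sl l j) + ln (normal_peak 1)).
    move: (ln (a l j)) (_ ^+ 2) ((1 - c) * _) (dl l) (c * _).
    by move=> u v w z y H; rewrite addrAC lerBlDr [leRHS]addrAC.
  rewrite /dl.
  have aK : ln (a l j) <= ln K.
    rewrite ler_ln ?posrE// /a /cell_average ler_pdivrMr// -!FqG.
    by apply: density_cdf_diff_le => //; rewrite -subr_ge0 ltW.
  have /andP[T1 T2] := T_itv _ _ _ xj.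
  have gj := @grid_bound R _ _ (ltnW jN); have gj1 := @grid_bound R _ _ jN.
  have TL : `|T l j x| <= l.+1%:R.
    by move: gj gj1; rewrite !ler_norml; lra.
  have L0 : 0 < l.+1%:R :> R by [].
  have L10 : 0 < l.+1%:R^-1 :> R by rewrite invr_gt0.
  rewrite /eta; case: eqVneq => [c0|c0].
    rewrite c0 mul0r addr0 subr0 mul1r exprMn exprVn.
    have : (l.+1%:R ^+ 2)^-1 * T l j x ^+ 2 <= 1.
      rewrite mulrC ler_pdivrMr ?exprn_gt0// mul1r -real_normK ?num_real//.
      by rewrite ler_sqr ?nnegrE.
    move: L10 aK; move: (l.+1%:R ^- 2 * _) (l.+1%:R^-1) (ln (a l j)) (ln K).
    by move=> z y u v y0 uv z1; clear -y0 uv z1; lra.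
  rewrite !mul1r.
  have {}c0 : 0 < c by rewrite lt_neqAle eq_sym c0; case/andP: c01.
  have sgE : sg = Num.sqrt c by rewrite /sg gt_eqF.
  have sg2 : sg ^+ 2 = c by rewrite sgE sqr_sqrtr// ltW.
  (* An upper bound for the Gaussian density on the whole cell in terms of its value at
     [T l j x]. *)
  pose m := normal_peak sg * expR (l.+1%:R^-1 / c - T l j x ^+ 2 / (c *+ 2)).
  have m0 : 0 < m by rewrite mulr_gt0 ?expR_gt0 ?normal_peak_gt0.
  have am : a l j <= sl l j * m.
    rewrite /a /cell_average /sl /cell_slope mulrAC ler_pM2r ?invr_gt0//.
    have -> : grid_step l = grid l j.+1 - grid l j :> R.
      by rewrite gridS addrAC subrr add0r.
    rewrite mulrC; apply: density_cdf_diff_le.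
    + exact: prob_density_normal.
    + by rewrite gridS lerDl ltW ?grid_step_gt0.
    move=> u /andP[u1 u2]; rewrite normal_pdf0E// ler_pM2l ?normal_peak_gt0//.
    rewrite ler_expR sg2.
    have h1 : `|T l j x - u| <= grid_step l.
      by move: T1 T2 u1 u2; rewrite gridS ler_norml; lra.
    have h2 : `|T l j x + u| <= l.+1%:R *+ 2.
      apply: (le_trans (ler_normD _ _)); rewrite mulr2n lerD//.
      by move: gj gj1; rewrite !ler_norml; lra.
    have h3 : T l j x ^+ 2 - u ^+ 2 <= l.+1%:R^-1 *+ 2.
      rewrite subr_sqr (le_trans (ler_norm _))// normrM.
      apply: (le_trans (ler_pM _ _ h1 h2)) => //.
      by rewrite grid_stepM.
    have -> : - u ^+ 2 / (c *+ 2) =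
        (T l j x ^+ 2 - u ^+ 2) / (c *+ 2) - T l j x ^+ 2 / (c *+ 2).
      by rewrite mulrBl mulNr addrAC subrr add0r.
    rewrite lerD2r ler_pdivrMr ?pmulrn_lgt0//.
    by rewrite mulrnAr divfK ?gt_eqF.
  have am2 : ln (a l j) <= ln (sl l j) + ln (normal_peak sg) +
      (l.+1%:R^-1 / c - T l j x ^+ 2 / (c *+ 2)).
    apply: (@le_trans _ _ (ln (sl l j * m))).
      by rewrite ler_ln ?posrE//; exact: mulr_gt0.
    by rewrite lnM ?posrE// [ln m]lnM ?posrE ?expR_gt0 ?normal_peak_gt0// expRK addrA.
  (* From ln (1/c) <= 1/c - 1. It bounds the normalisation c^(-c/2) of the Gaussian by exp ((1 - c)
     / 2). *)
  have cln : - (c * ln c) <= 1 - c.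
    have ic : -1 < c^-1 - 1 by rewrite ltrBrDl subrr invr_gt0.
    have := le_ln1Dx ic; rewrite addrCA subrr addr0 lnV ?posrE// => lnc.
    have : c * - ln c <= c * (c^-1 - 1) by rewrite ler_pM2l.
    by rewrite mulrN mulrBr mulfV ?gt_eqF// mulr1.
  have lnsg : ln `|sg| = ln c / 2.
    rewrite sgE ger0_norm ?sqrtr_ge0// -[in RHS](sqr_sqrtr (ltW c0)).
    by rewrite lnXn ?sqrtr_gt0// [RHS]mulrnAl -[RHS]mulr_natr divfK ?pnatr_eq0.
  move: am2; rewrite ln_normal_peak// lnsg => am2.
  (* Of [ln (a l j)], the share c is bounded through the transport and the share 1 - c, in [am4], by
     [ln K]. *)
  have am3 : c * ln (a l j) <= c * (ln (sl l j) + ln (normal_peak 1)) -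
      (c * ln c) / 2 + l.+1%:R^-1 - T l j x ^+ 2 / 2.
    apply: (@le_trans _ _ (c * (ln (sl l j) + (ln (normal_peak 1) - ln c / 2) +
      (l.+1%:R^-1 / c - T l j x ^+ 2 / (c *+ 2))))); first by rewrite ler_pM2l.
    have -> (u v w z : R) : c * (u + (v - w / 2) + (z / c - T l j x ^+ 2 / (c *+ 2))) =
        c * (u + v) - (c * w) / 2 + z - T l j x ^+ 2 / 2.
      by move: (T l j x ^+ 2) => y; rewrite -(mulr_natr c); field; rewrite gt_eqF.
    by [].
  have am4 : (1 - c) * ln (a l j) <= (1 - c) * ln K.
    by rewrite ler_wpM2l// subr_ge0; case/andP: c01.
  have c1 : 0 <= 1 - c by rewrite subr_ge0; case/andP: c01.
  move: am3 am4 cln c1; move: (ln (a l j)) (ln (sl l j)) (ln (normal_peak 1)).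
  move: (l.+1%:R^-1) (T l j x ^+ 2) (ln K) (ln c) => Li Tx lK lc la ls lp.
  by clear; lra.
- have := density_cdf_derive df.
  apply: filterS; first exact: (ae_filter_ringOfSetsType mu).
  (* The gap between [th] and [th'] leaves room for the factor [expR (- dl l)], which tends to 1. *)
  move=> x Fx fx th /andP[th0 th1]; pose th' := (1 + th) / 2.
  have th'1 : th' < 1 by rewrite /th'; lra.
  have thth' : th < th' by rewrite /th'; lra.
  have [r r0 Fr] := Fx fx th' th'1.
  have near_cells : \forall l \near \oo, exists j, [/\ (j < grid_size l)%N,
      q (grid l j) <= x < q (grid l j.+1) & th' * f x <= a l j].
  apply: (@cells_near _ F Gam q _ F_ndecr F01 Gi _ _ FqG x (th' * f x) r).
  + by move=> u v uv; exact: (normal_cdf_lip sg0 uv).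
  + by move=> u u01; exact: normal_cdf_surj.
  + by rewrite mulr_gt0// (lt_trans th0).
  + by [].
  + exact: Fr.
  near=> l; have [j [jN xj aj]] : exists j, [/\ (j < grid_size l)%N,
      q (grid l j) <= x < q (grid l j.+1) & th' * f x <= a l j].
    by near: l.
  exists j; split => //.
  have expl : th / th' <= expR (- dl l).
    have th'0 : 0 < th' by exact: lt_trans thth'.
    have -> : th / th' = expR (ln (th / th')) by rewrite lnK// posrE divr_gt0.
    rewrite ler_expR lerNr /dl -[leRHS]invrK.
    have lnth : 0 < - ln (th / th').
      by rewrite oppr_gt0 ln_lt0// divr_gt0//= ltr_pdivrMr// mul1r.
    rewrite lef_pV2 ?posrE ?invr_gt0//; apply: (@le_trans _ _ l%:R); last by rewrite ler_nat.
    by near: l; exact: nbhs_infty_ger.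
  have th'0 : 0 < th' by exact: lt_trans thth'.
  rewrite -[th](@divfK _ th') ?gt_eqF// -[leLHS]mulrA [leRHS]mulrC.
  by apply: ler_pM => //; apply: ltW; [exact: divr_gt0|exact: mulr_gt0].
Unshelve. all: by end_near. Qed.
End steps.
End gaussian_steps.

(** * Projections and Gaussians on fibres *)

Section frame_pair.
Context {R : realType} (d m : nat).
Variables (A : 'M[R]_(d, d + m)) (H : 'M[R]_(m, d + m)).
Hypotheses (AA : A *m A^T = 1%:M) (HH : H *m H^T = 1%:M) (AH : A *m H^T = 0).

Let HA : H *m A^T = 0.
Proof. by rewrite -[LHS]trmxK trmx_mul trmxK AH trmx0. Qed.

Let frame : 'M[R]_(d + m) := col_mx A H.

Let frameK : frame *m frame^T = 1%:M.
Proof.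
by rewrite /frame tr_col_mx mul_col_row AA HH AH HA -scalar_mx_block.
Qed.

Let frame_unit : frame \in unitmx. Proof. by have [] := mulmx1_unit frameK. Qed.

Let det_frame2 : \det frame ^+ 2 = 1.
Proof. by rewrite expr2 -{2}det_tr -det_mulmx frameK det1. Qed.

Let norm_det_frame : `|\det frame| = 1.
Proof. by apply/eqP; rewrite -sqrp_eq1// real_normK ?num_real// det_frame2. Qed.

Lemma frame_resolution : A^T *m A + H^T *m H = 1%:M.
Proof. by have := mulmx1C frameK; rewrite /frame tr_col_mx mul_row_col. Qed.

(* The linear part of x |-> A^T A x + Q S(x) on a box where the coordinates of S
   are affine with slopes t; here Q = H^T H. *)
Definition transport_mx (t : 'rV[R]_(d + m)) : 'M[R]_(d + m) :=
  A^T *m A + H^T *m H *m diag_mx t.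

Lemma mulA_transport t : A *m transport_mx t = A.
Proof.
by rewrite mulmxDr !mulmxA AA mul1mx AH !mul0mx addr0.
Qed.

Lemma mulH_transport t : H *m transport_mx t = H *m diag_mx t.
Proof.
by rewrite mulmxDr !mulmxA HA !mul0mx add0r HH mul1mx.
Qed.

(** Conjugation by the orthogonal matrix with blocks A and H makes the map block lower triangular,
    with diagonal blocks 1 and H D H^T. *)
Lemma det_transport t : \det (transport_mx t) = \det (H *m diag_mx t *m H^T).
Proof.
rewrite -[LHS]mul1r -det_frame2 expr2 -{2}[\det frame]det_tr -mulrA.
rewrite [X in _ * X]mulrC mulrA -!det_mulmx /frame mul_col_mx.
rewrite mulA_transport mulH_transport tr_col_mx mul_col_row AA AH.
by rewrite det_lblock det1 mul1r.
Qed.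

(** The diagonal entry c_i = Q_ii, since Q = H^T H. *)
Definition coord_weight (i : 'I_(d + m)) : R := \sum_k H k i ^+ 2.

Lemma coord_weight_compl i : 1 - coord_weight i = \sum_k A k i ^+ 2.
Proof.
have := congr1 (fun M : 'M[R]_(d + m) => M i i) frame_resolution.
rewrite mxE [X in X + _]mxE [X in _ + X]mxE [RHS]mxE eqxx mulr1n => <-.
rewrite (_ : coord_weight i = \sum_k H^T i k * H k i) ?addrK.
  by apply: eq_bigr => k _; rewrite mxE expr2.
by apply: eq_bigr => k _; rewrite mxE expr2.
Qed.

Lemma coord_weight_itv i : 0 <= coord_weight i <= 1.
Proof.
apply/andP; split; first by apply: sumr_ge0 => k _; exact: sqr_ge0.
by rewrite -subr_ge0 coord_weight_compl sumr_ge0// => k _; exact: sqr_ge0.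
Qed.

Lemma sum_row_sqr p (M : 'M[R]_(p, d + m)) : M *m M^T = 1%:M ->
  \sum_i \sum_k M k i ^+ 2 = p%:R.
Proof.
move=> MM; rewrite exchange_big/= -[p in RHS]card_ord -sumr_const.
apply: eq_bigr => k _.
have := congr1 (fun N : 'M[R]_p => N k k) MM; rewrite !mxE eqxx mulr1n => <-.
by apply: eq_bigr => i _; rewrite mxE expr2.
Qed.

Lemma dot_frame (u v : 'cV[R]_(d + m)) :
  \sum_i u i 0 * v i 0 =
  \sum_k (A *m u) k 0 * (A *m v) k 0 + \sum_k (H *m u) k 0 * (H *m v) k 0.
Proof.
have dotE p (x y : 'cV[R]_p) : \sum_i x i 0 * y i 0 = (x^T *m y) 0 0.
  by rewrite mxE; apply: eq_bigr => i _; rewrite mxE.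
rewrite !dotE; have -> : u^T *m v =
    (A *m u)^T *m (A *m v) + (H *m u)^T *m (H *m v); last by rewrite mxE.
rewrite -[v in LHS]mul1mx -frame_resolution mulmxDl mulmxDr !trmx_mul.
by rewrite !mulmxA.
Qed.

Definition kernel_gauss (z : 'cV[R]_m) : R := \prod_k normal_pdf 0 1 (z k 0).

Lemma kernel_gaussE z : kernel_gauss z =
  expR (m%:R * ln (normal_peak 1) - (\sum_k z k 0 ^+ 2) / 2).
Proof.
have -> : m%:R * ln (normal_peak 1) - (\sum_k z k 0 ^+ 2) / 2 =
    \sum_k (ln (normal_peak 1) - z k 0 ^+ 2 / 2).
  by rewrite sumrB sumr_const card_ord mulr_natl mulr_suml.
rewrite expR_sum; apply: eq_bigr => k _.
rewrite normal_pdf0E ?oner_eq0// expRD lnK ?posrE ?normal_peak_gt0 ?oner_eq0//.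
by rewrite expr1n mulNr.
Qed.

Lemma kernel_gauss_ge0 z : 0 <= kernel_gauss z.
Proof. by rewrite kernel_gaussE expR_ge0. Qed.

Lemma measurable_kernel_gauss : measurable_fun setT kernel_gauss.
Proof.
apply: (@measurable_prod_entries _ _ (fun=> normal_pdf 0 1)) => i.
exact: measurable_normal_pdf.
Qed.

(** The test function on R^n: in the orthonormal coordinates (A y, H y) it is a product. *)
Definition fiber_gauss (B : set 'cV[R]_d) (y : 'cV[R]_(d + m)) : R :=
  \1_B (A *m y) * kernel_gauss (H *m y).

Lemma fiber_gauss_ge0 B y : 0 <= fiber_gauss B y.
Proof. by rewrite mulr_ge0// kernel_gauss_ge0. Qed.

Lemma measurable_fiber_gauss B : measurable B ->
  measurable_fun setT (fiber_gauss B).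
Proof.
move=> mB; apply: measurable_funM.
  by apply: (measurableT_comp (measurable_indic _)) => //; exact: measurable_mulmx.
by apply: (measurableT_comp measurable_kernel_gauss); exact: measurable_mulmx.
Qed.

(** The change to the coordinates (A y, H y) has determinant of absolute value 1, and the Gaussian
    factor integrates to 1. *)
Lemma integral_fiber_gauss (B : set 'cV[R]_d) : measurable B ->
  (\int[leb (d + m)]_y (fiber_gauss B y)%:E = leb d B)%E.
Proof.
move=> mB.
pose Phi (w : 'cV[R]_(d + m)) :=
  ((\1_B (usubmx w))%:E * (kernel_gauss (dsubmx w))%:E)%E.
have m1 : measurable_fun setT (fun u : 'cV[R]_d => (\1_B u)%:E : \bar R).
  by apply/measurable_EFinP; exact: measurable_indic.
have m2 : measurable_fun setT (fun u => (kernel_gauss u)%:E).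
  by apply/measurable_EFinP; exact: measurable_kernel_gauss.
have mPhi : measurable_fun setT Phi.
  apply: emeasurable_funM.
    by apply: (measurableT_comp m1); exact: measurable_usubmx.
  by apply: (measurableT_comp m2); exact: measurable_dsubmx.
have Phi0 w : (0 <= Phi w)%E.
  by rewrite mule_ge0 ?lee_fin ?kernel_gauss_ge0.
have := unitmx_scales_leb frame_unit mPhi Phi0.
rewrite norm_det_frame mul1e => E.
transitivity (\int[leb (d + m)]_w Phi w)%E.
  rewrite -E; apply: eq_integral => y _.
  by rewrite /Phi /fiber_gauss /frame mul_col_mx col_mxKu col_mxKd EFinM.
have i0 x : (0 <= (\1_B x)%:E :> \bar R)%E by rewrite lee_fin.
have k0 x : (0 <= (kernel_gauss x)%:E)%E by rewrite lee_fin kernel_gauss_ge0.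
rewrite (leb_split m1 i0 m2 k0).
have -> : (\int[leb m]_z (kernel_gauss z)%:E = 1)%E.
  rewrite (@leb_prod _ _ (fun=> normal_pdf 0 1)); last 2 first.
  - by move=> _; exact: measurable_normal_pdf.
  - by move=> _; exact: normal_pdf_ge0.
  by apply: big1 => k _; exact: integral_normal_pdf.
rewrite mule1; apply: etrans (integral_indic (leb d) measurableT mB) _.
by rewrite setIT.
Qed.

End frame_pair.

(** * Brascamp-Lieb inequality for step functions *)

Section steps_inequality.
Context {R : realType} (d m : nat).
Variables (A : 'M[R]_(d, d + m)) (H : 'M[R]_(m, d + m)).
Hypotheses (AA : A *m A^T = 1%:M) (HH : H *m H^T = 1%:M) (AH : A *m H^T = 0).
Local Notation n := (d + m)%N.
Variables (N : nat) (q a s t : 'I_n -> nat -> R) (kap : R).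
Hypothesis q_incr : forall i j k, (j < k)%N -> q i j < q i k.
Hypothesis as_gt0 : forall i j, 0 < a i j /\ 0 < s i j.
Hypothesis st_mono : forall i j k x y, q i j <= x < q i j.+1 ->
  q i k <= y < q i k.+1 -> x < y -> s i j * x + t i j < s i k * y + t i k.
Hypothesis a_bound : forall i j x, (j < N)%N -> q i j <= x < q i j.+1 ->
  ln (a i j) + (s i j * x + t i j) ^+ 2 / 2 <=
  (1 - coord_weight H i) * kap +
  coord_weight H i * (ln (s i j) + ln (normal_peak 1)).

Definition step_fun (i : 'I_n) (x : R) : R :=
  \sum_(j < N) a i j * \1_(`[q i j, q i j.+1[%classic) x.

Local Notation index := {ffun 'I_n -> 'I_N}.

Let box (k : index) : set 'cV[R]_n :=
  [set x | forall i, `[q i (k i), q i (k i).+1[%classic (x i ord0)].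

Let slope (k : index) : 'rV[R]_n := \row_i s i (k i).

Let offset (k : index) : 'cV[R]_n := \col_i t i (k i).

Let M (k : index) : 'M[R]_n := transport_mx A H (slope k).

Let v (k : index) : 'cV[R]_n := H^T *m H *m offset k.

Let S (k : index) (x : 'cV[R]_n) : 'cV[R]_n := diag_mx (slope k) *m x + offset k.

Let SE k x i : S k x i 0 = s i (k i) * x i 0 + t i (k i).
Proof. by rewrite mxE mul_diag_mx !mxE. Qed.

Let slope_gt0 k i : 0 < slope k 0 i.
Proof. by rewrite mxE; have [] := as_gt0 i (k i). Qed.

Let A_transport k x : A *m (M k *m x + v k) = A *m x.
Proof.
by rewrite mulmxDr !mulmxA mulA_transport// AH !mul0mx addr0.
Qed.

Let H_transport k x : H *m (M k *m x + v k) = H *m S k x.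
Proof.
rewrite mulmxDr !mulmxA mulH_transport// HH mul1mx /S mulmxDr.
by rewrite !mulmxA.
Qed.

Let cell_uniq i j k x : q i j <= x < q i j.+1 -> q i k <= x < q i k.+1 -> j = k.
Proof.
have le_q j1 j2 : (j1 <= j2)%N -> q i j1 <= q i j2.
  by rewrite leq_eqVlt => /predU1P[->//|/q_incr/ltW].
move=> /andP[j1 j2] /andP[k1 k2]; have [jk|kj|//] := ltngtP j k.
  by have := le_lt_trans (le_trans (le_q _ _ jk) k1) j2; rewrite ltxx.
by have := le_lt_trans (le_trans (le_q _ _ kj) j1) k2; rewrite ltxx.
Qed.

(** If the images agree, x - x' lies in ker A and the difference of the values of S is orthogonal to
    ker A, so their inner product is 0. As S is increasing in each coordinate, every term is
    nonnegative and vanishes only if the coordinates agree; hence x = x', and the boxes coincide. *)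
Let transport_inj k k' x x' : box k x -> box k' x' ->
  M k *m x + v k = M k' *m x' + v k' -> k = k'.
Proof.
move=> kx kx' E.
have Ax : A *m (x - x') = 0.
  by rewrite mulmxBr -(A_transport k) E A_transport subrr.
have HS : H *m (S k x - S k' x') = 0.
  by rewrite mulmxBr -!H_transport E subrr.
have mono i : 0 <= (x - x') i 0 * (S k x - S k' x') i 0 ?= iff (x i 0 == x' i 0).
  have -> : (x - x') i 0 = x i 0 - x' i 0 by rewrite !mxE.
  have -> : (S k x - S k' x') i 0 = S k x i 0 - S k' x' i 0.
    by rewrite mxE [X in _ + X]mxE.
  rewrite !SE.
  have := kx i; have := kx' i; rewrite /= !in_itv/= => kx'i kxi.
  have [xx'|xx'|->] := ltgtP (x i 0) (x' i 0).
  - have lt := st_mono kxi kx'i xx'.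
    by apply/leifP; rewrite -mulrNN mulr_gt0// oppr_gt0 subr_lt0.
  - have lt := st_mono kx'i kxi xx'.
    by apply/leifP; rewrite mulr_gt0// subr_gt0.
  - by rewrite subrr mul0r; apply/leifP.
have : \sum_i (x - x') i 0 * (S k x - S k' x') i 0 = 0.
  rewrite (dot_frame AA HH AH) Ax HS big1 ?add0r => [|i _].
    by rewrite big1// => i _; rewrite [X in _ * X]mxE mulr0.
  by rewrite [X in X * _]mxE mul0r.
move/eqP; rewrite eq_sym.
have := leif_sum (P := xpredT) (fun i _ => mono i).
rewrite big1// => [[_ ->]] /forallP xE.
apply/ffunP => i; apply: val_inj.
have := kx i; have := kx' i; rewrite /= !in_itv/= (eqP (xE i)) => kx'i kxi.
exact: cell_uniq kxi kx'i.
Qed.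

(** Sum the logarithmic bounds over i: the weights 1 - c_i add up to d and the c_i to m, which is
    the number of Gaussian normalisations in [kernel_gauss]. Then use [ln_det_frame] and |H S| <=
    |S|. *)
Let box_bound k x : box k x ->
  \prod_i a i (k i) <= expR (d%:R * kap) * \det (M k) *
    kernel_gauss (H *m (M k *m x + v k)).
Proof.
move=> kx.
have a0 : 0 < \prod_i a i (k i).
  by apply: prodr_gt0 => i _; have [] := as_gt0 i (k i).
have detE : \det (M k) = \det (H *m diag_mx (slope k) *m H^T).
  exact: det_transport.
have det0 : 0 < \det (M k) by rewrite detE det_frame_gt0.
rewrite H_transport kernel_gaussE.
rewrite -[leLHS]lnK ?posrE// -[\det (M k)]lnK ?posrE// -!expRD ler_expR.
rewrite ln_prod; last by move=> i _; have [] := as_gt0 i (k i).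
have le_det : \sum_i coord_weight H i * ln (s i (k i)) <= ln (\det (M k)).
  rewrite detE (le_trans _ (ln_det_frame HH (slope_gt0 k)))//.
  by rewrite le_eqVlt; apply/orP; left; apply/eqP; apply: eq_bigr => i _; rewrite mxE.
have le_sqr : \sum_k0 (H *m S k x) k0 0 ^+ 2 <= \sum_i S k x i 0 ^+ 2.
  under [leRHS]eq_bigr do rewrite expr2.
  rewrite (dot_frame AA HH AH) [leRHS]addrC -[leLHS]addr0 lerD//.
  by apply: sumr_ge0 => i _; rewrite -expr2 sqr_ge0.
have sum_compl : \sum_i (1 - coord_weight H i) = d%:R.
  under eq_bigr do rewrite (coord_weight_compl AA HH AH).
  exact: sum_row_sqr.
have sum_weight : \sum_i coord_weight H i = m%:R by exact: sum_row_sqr.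
have : \sum_i (ln (a i (k i)) + S k x i 0 ^+ 2 / 2) <=
    \sum_i ((1 - coord_weight H i) * kap +
      coord_weight H i * (ln (s i (k i)) + ln (normal_peak 1))).
  apply: ler_sum => i _; rewrite SE; apply: a_bound => //.
  by have := kx i; rewrite /= in_itv.
rewrite !big_split/= -!mulr_suml sum_compl.
under [X in _ <= _ + X]eq_bigr do rewrite mulrDr.
rewrite big_split/= -mulr_suml sum_weight.
move: le_det le_sqr; set s1 := \sum_i ln _; set s2 := \sum_i S _ _ _ _ ^+ 2.
set s3 := \sum_i _ * ln _; set s4 := \sum_i _ ^+ 2; set l := ln (\det _).
move: (d%:R * kap) (m%:R * _) => dk mp.
lra.
Qed.

Let boxE (k : index) (x : 'cV[R]_n) : \prod_i \1_(`[q i (k i), q i (k i).+1[%classic) (x i 0) =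
  \1_(box k) x :> R.
Proof.
have [kx|kx] := pselect (box k x).
  by rewrite [RHS]indicE mem_set// big1// => i _; rewrite indicE mem_set//; exact: kx.
rewrite [RHS]indicE memNset//; move/existsNP : kx => [i xi].
by rewrite (bigD1 i)//= indicE memNset// mul0r.
Qed.

Let measurable_box_k k : measurable (box k).
Proof.
apply: (@measurable_box _ _ (fun i => `[q i (k i), q i (k i).+1[%classic)) => i.
exact: measurable_itv.
Qed.

Let C := expR (d%:R * kap).

Variable B : set 'cV[R]_d.
Hypothesis mB : measurable B.

Let Psi := fiber_gauss A H B.

Let mPsi : measurable_fun setT Psi.
Proof. exact: measurable_fiber_gauss. Qed.

Let Psi_ge0 y : 0 <= Psi y.
Proof. exact: fiber_gauss_ge0. Qed.

Let M_unit k : M k \in unitmx.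
Proof.
by rewrite unitmxE unitfE gt_eqF// [X in 0 < X]det_transport// det_frame_gt0.
Qed.

Let det_gt0 k : 0 < \det (M k).
Proof. by rewrite [X in 0 < X]det_transport// det_frame_gt0. Qed.

Let measurable_inv_box k :
  measurable_fun setT (fun y : 'cV[R]_n => \1_(box k) (invmx (M k) *m (y - v k)) : R).
Proof.
apply: (measurableT_comp (measurable_indic _)) => //.
apply: (measurableT_comp (@measurable_mulmx _ _ _ (invmx (M k)))).
exact: measurable_addmx.
Qed.

Let integral_box k :
  ((\det (M k))%:E * \int[leb n]_x (\1_(box k) x * Psi (M k *m x + v k)%R)%:E =
  \int[leb n]_y (\1_(box k) (invmx (M k) *m (y - v k)%R) * Psi y)%:E)%E.
Proof.
pose G1 (y : 'cV[R]_n) : \bar R := (\1_(box k) (invmx (M k) *m (y - v k)) * Psi y)%:E.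
have mG1 : measurable_fun setT G1.
  by apply/measurable_EFinP; exact: measurable_funM.
have G10 y : (0 <= G1 y)%E by rewrite lee_fin mulr_ge0.
rewrite -[RHS](leb_shift (v k) mG1 G10).
have mG0 : measurable_fun setT (fun y : 'cV[R]_n => G1 (y + v k)).
  by apply: measurableT_comp => //; exact: measurable_addmx.
rewrite -(unitmx_scales_leb (M_unit k) mG0 (fun y => G10 _)) gtr0_norm//.
congr (_ * _)%E; apply: eq_integral => x _.
by rewrite /G1 addrK mulKmx.
Qed.

Let sum_box_le1 y :
  \sum_(k : index) \1_(box k) (invmx (M k) *m (y - v k)) <= 1 :> R.
Proof.
have [[k kx]|nk] := pselect (exists k, box k (invmx (M k) *m (y - v k))).
  rewrite (bigD1 k)//= indicE mem_set// big1 ?addr0// => k' kk'.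
  rewrite indicE memNset// => k'x; move/eqP : kk'; apply.
  apply: transport_inj k'x kx _.
  by rewrite !mulmxA !mulmxV// !mul1mx !subrK.
rewrite big1// => k _; rewrite indicE memNset// => kx.
by apply: nk; exists k.
Qed.

(** The product of step functions is a sum over boxes. On each box [box_bound] supplies the Jacobian
    of the affine map, a change of variables moves the integral to the image of the box, and these
    images are disjoint. *)
Lemma steps_inequality :
  (\int[leb n]_x (\1_B (A *m x) * \prod_i step_fun i (x i ord0))%:E <=
   C%:E * leb d B)%E.
Proof.
rewrite -(integral_fiber_gauss AA HH AH mB).
have m1 k : measurable_fun setT (fun x : 'cV[R]_n =>
    (\1_(box k) x * Psi (M k *m x + v k))%:E : \bar R).
  apply/measurable_EFinP; apply: measurable_funM; first exact: measurable_indic.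
  apply: (measurableT_comp mPsi); apply: measurable_addmx => //.
  exact: measurable_mulmx.
have m2 k : measurable_fun setT (fun y : 'cV[R]_n =>
    (\1_(box k) (invmx (M k) *m (y - v k)) * Psi y)%:E : \bar R).
  by apply/measurable_EFinP; exact: measurable_funM.
have C0 : 0 < C by exact: expR_gt0.
have Cdet k : 0 <= C * \det (M k) by rewrite ltW// mulr_gt0.
have boxPsi k x y : 0 <= \1_(box k) x * Psi y by rewrite mulr_ge0.
apply: (@le_trans _ _ (\int[leb n]_x (\sum_(k : index) ((C * \det (M k))%:E *
    (\1_(box k) x * Psi (M k *m x + v k)%R)%:E)))%E).
  apply: ge0_le_integral => //.
  - move=> x _; rewrite lee_fin mulr_ge0// prodr_ge0// => i _.
    by apply: sumr_ge0 => j _; rewrite mulr_ge0// ltW//; have [] := as_gt0 i j.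
  - apply/measurable_EFinP; apply: measurable_funM.
      by apply: (measurableT_comp (measurable_indic _)) => //; exact: measurable_mulmx.
    apply: measurable_prod_entries => i; apply: measurable_sum => j.
    by apply: measurable_funM => //; apply: measurable_indic; exact: measurable_itv.
  - by apply: emeasurable_sum => k; exact: measurable_funeM.
  - move=> x _; rewrite /step_fun (bigA_distr_bigA (fun i (j : 'I_N) =>
      a i j * \1_(`[q i j, q i j.+1[%classic) (x i ord0))) mulr_sumr.
    under [leRHS]eq_bigr do rewrite -EFinM.
    rewrite sumEFin lee_fin; apply: ler_sum => k _.
    rewrite big_split/= boxE.
    have [kx|kx] := pselect (box k x); last first.
      by rewrite [\1_(box k) x]indicE memNset// mul0r !mulr0.
    rewrite [\1_(box k) x]indicE mem_set// mul1r mulr1 /Psi /fiber_gauss.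
    rewrite A_transport mulrCA ler_wpM2l// -/(M k).
    exact: box_bound.
rewrite ge0_integral_sum//; last 2 first.
- by move=> k; exact: measurable_funeM.
- by move=> k x _; rewrite mule_ge0 ?lee_fin.
apply: (@le_trans _ _ (C%:E * \int[leb n]_y (\sum_(k : index)
    (\1_(box k) (invmx (M k) *m (y - v k)%R) * Psi y)%:E))%E).
  rewrite ge0_integral_sum//; last first.
    by move=> k y _; rewrite lee_fin mulr_ge0.
  rewrite ge0_sume_distrr; last first.
    by move=> k _; apply: integral_ge0 => y _; rewrite lee_fin mulr_ge0.
  apply: lee_sum => k _; rewrite (ge0_integralZl (leb n) measurableT (m1 k)).
  - by rewrite EFinM -muleA integral_box.
  - by move=> x _; rewrite lee_fin.
  - by rewrite lee_fin.
rewrite lee_pmul2l ?lte_fin//; apply: ge0_le_integral => //.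
- by move=> y _; apply: sume_ge0 => k _; rewrite lee_fin mulr_ge0.
- by apply: emeasurable_sum => k.
- exact/measurable_EFinP.
move=> y _; rewrite sumEFin lee_fin -mulr_suml -[leRHS]mul1r.
by rewrite ler_wpM2r.
Qed.

End steps_inequality.

(** * Brascamp-Lieb inequality for bounded densities *)

Section product_density.
Context {R : realType}.
Local Notation Rm := (measurableTypeR R).
Local Notation mu := (@lebesgue_measure R).

Lemma limn_einf_sup_einfs (u : (\bar R)^nat) :
  limn_einf u = ereal_sup (range (einfs u)).
Proof. by rewrite limn_einf_lim; apply/cvg_lim => //; exact: cvg_einfs_sup. Qed.

Lemma le_limn_einf_near (u : (\bar R)^nat) (c : \bar R) :
  (\forall n \near \oo, (c <= u n)%E) -> (c <= limn_einf u)%E.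
Proof.
move=> [n _ cu]; rewrite limn_einf_sup_einfs.
apply: (@le_trans _ _ (einfs u n)).
  by apply: le_ereal_inf_tmp => _ [k /= nk <-]; exact: cu.
by apply: ereal_sup_ubound; exists n.
Qed.

Lemma limn_einf_le (u : (\bar R)^nat) (c : \bar R) :
  (forall n, (u n <= c)%E) -> (limn_einf u <= c)%E.
Proof.
move=> uc; rewrite limn_einf_sup_einfs; apply: ge_ereal_sup => _ [n _ <-].
apply: (@le_trans _ _ (u n)) => //.
by apply: ereal_inf_lbound; exists n => /=.
Qed.

(** The exceptional set of coordinate i is a cylinder over a null set; its measure is a product with
    a factor 0, and 0 * +oo = 0. *)
Lemma ae_entries n (P : 'I_n -> set R) :
  (forall i, {ae mu, forall x, P i x}) ->
  {ae leb n, forall x : 'cV[R]_n, forall i, P i (x i ord0)}.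
Proof.
move=> aeP; apply: filter_forall => i.
have [N [mN N0 PN]] := aeP i.
exists [set x : 'cV[R]_n | N (x i ord0)]; split.
- rewrite -[X in measurable X]setTI.
  by apply: (@measurable_fun_entry _ n 1 i ord0).
- rewrite -[X in leb n X]setIT -integral_indic//; last first.
    rewrite -[X in measurable X]setTI.
    by apply: (@measurable_fun_entry _ n 1 i ord0).
  transitivity (\int[leb n]_x (\prod_k (if k == i then \1_N (x k ord0) else 1))%:E)%E.
    apply: eq_integral => x _; rewrite (bigD1 i)//= eqxx big1 ?mulr1//.
    by move=> k /negPf ->.
  rewrite (@leb_prod _ _ (fun k x => if k == i then \1_N x else 1)).
  + rewrite (bigD1 i)//= eqxx integral_indic// setIT.
    by apply: (etrans (congr1 (fun z => (z * _)%E) N0)); exact: mul0e.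
  + by move=> k; case: (k == i); [exact: measurable_indic|exact: measurable_cst].
  + by move=> k x; case: (k == i).
- by move=> x /= Px; apply: PN => /= Pi; apply: Px.
Qed.

Section bound.
Context (d m : nat).
Variables (A : 'M[R]_(d, d + m)) (H : 'M[R]_(m, d + m)).
Hypotheses (AA : A *m A^T = 1%:M) (HH : H *m H^T = 1%:M) (AH : A *m H^T = 0).
Variables (f : 'I_(d + m) -> R -> R) (K : R).
Hypotheses (df : forall i, prob_density (f i)) (fK : forall i x, f i x <= K).
Hypothesis K0 : 0 < K.

Lemma product_density_bound_frame (B : set 'cV[R]_d) : measurable B ->
  (\int[leb (d + m)]_x (\1_B (A *m x) * \prod_i f i (x i ord0))%:E <=
   ((expR 1 * K) ^+ d)%:E * leb d B)%E.
Proof.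
move=> mB.
have [q] := choice (fun i => gaussian_steps (df i) (fK i) K0
  (coord_weight_itv AA HH AH i)).
move=> /choice[a] /choice[s] /choice[t] steps.
pose g l (x : 'cV[R]_(d + m)) : \bar R := (\1_B (A *m x) *
  \prod_i step_fun (grid_size l) (fun i => q i l) (fun i => a i l) i (x i ord0))%:E.
have mA : measurable_fun setT (fun x : 'cV[R]_(d + m) => \1_B (A *m x) : R).
  apply: (measurableT_comp (measurable_indic _)) => //.
  exact: measurable_mulmx.
have a0 i l j : 0 < a i l j by have [_ /(_ l j)[]] := steps i.
have mg l : measurable_fun setT (g l).
  apply/measurable_EFinP; apply: measurable_funM => //.
  apply: measurable_prod_entries => i; apply: measurable_sum => j.
  by apply: measurable_funM => //; apply: measurable_indic; exact: measurable_itv.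
have step0 l i x : 0 <= step_fun (grid_size l) (fun i => q i l) (fun i => a i l) i x.
  by apply: sumr_ge0 => j _; rewrite mulr_ge0// ltW.
have g0 l x : (0 <= g l x)%E by rewrite lee_fin mulr_ge0// prodr_ge0.
(* The exponent is d times the value ln K + 1 of [kap] provided by [gaussian_steps]. *)
have -> : (expR 1 * K) ^+ d = expR (d%:R * (ln K + 1)).
  by rewrite expRM_natl expRD lnK ?posrE// mulrC.
have int_g l : (\int[leb (d + m)]_x g l x <=
    (expR (d%:R * (ln K + 1)))%:E * leb d B)%E.
  apply: (@steps_inequality _ _ _ A H AA HH AH (grid_size l) _ _
    (fun i => s i l) (fun i => t i l)) => //.
  - by move=> i; have [+ _ _ _ _] := steps i; apply.
  - by move=> i; have [_ + _ _ _] := steps i; apply.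
  - by move=> i; have [_ _ + _ _] := steps i; apply.
  - by move=> i; have [_ _ _ + _] := steps i; apply.
have mf : measurable_fun setT (fun x : 'cV[R]_(d + m) =>
    (\1_B (A *m x) * \prod_i f i (x i ord0))%:E : \bar R).
  apply/measurable_EFinP; apply: measurable_funM => //.
  by apply: measurable_prod_entries => i; case: (df i).
have f0 i x : 0 <= f i x by case: (df i).
have fp0 (x : 'cV[R]_(d + m)) :
    (0 <= (\1_B (A *m x) * \prod_i f i (x i ord0))%:E :> \bar R)%E.
  by rewrite lee_fin mulr_ge0// prodr_ge0.
(* The averages are only known to exceed [th * f] eventually, for each [th] below 1; hence the bound
   is shown for r times the integral, for every r in ]0, 1[. *)
apply/lee_mul01Pr; first exact: integral_ge0.
move=> r r01; have /andP[r0 r1] := r01.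
rewrite -ge0_integralZl//; last by rewrite lee_fin ltW.
apply: (@le_trans _ _ (\int[leb (d + m)]_x limn_einf (g^~ x))%E); last first.
  apply: (le_trans (fatou _ _ _ _)) => //.
  exact: limn_einf_le.
apply: ae_ge0_le_integral => //.
- by move=> x _; rewrite mule_ge0// lee_fin ltW.
- exact: measurable_funeM.
- by move=> x _; apply: le_limn_einf_near; exact: nearW.
(* The lower limit is minus the upper limit of the opposite sequence. *)
- apply: (measurableT_comp (f := -%E)) => //.
  apply: (@measurable_fun_limn_esup _ _ _ _ (fun l x => - g l x)%E) => // l.
  exact: measurableT_comp.
have := @ae_entries _ (fun i x => 0 < f i x -> forall th, 0 < th < 1 ->
        \forall l \near \oo, exists j, [/\ (j < grid_size l)%N,
          q i l j <= x < q i l j.+1 & th * f i x <= a i l j]).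
move=> /(_ (fun i => let: And5 _ _ _ _ P := steps i in P)).
apply: filterS => x near_x _.
have [fx|] := pselect (forall i, 0 < f i (x i ord0)); last first.
  move=> /existsNP[i /negP]; rewrite -leNgt => fi0.
  have fi : f i (x i ord0) = 0 by apply/eqP; rewrite eq_le fi0 f0.
  rewrite (bigD1 i)//= fi mul0r mulr0 mule0.
  by apply: le_limn_einf_near; exact: nearW.
(* With n = d + m, [th] is r^(1/(n+1)), so th^n >= r; n + 1 instead of n avoids a division by 0. *)
pose th := expR (ln r / (d + m).+1%:R).
have lnr : ln r < 0 by exact: ln_lt0.
have th01 : 0 < th < 1.
  rewrite expR_gt0/= -[X in _ < X]expR0 ltr_expR.
  by rewrite pmulr_llt0// invr_gt0.
have th_r : r <= th ^+ (d + m).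
  rewrite -expRM_natl -[leLHS](lnK r0) ler_expR.
  rewrite mulrCA -[leLHS]mulr1 ler_nM2l// ler_pdivrMr// mul1r ler_nat.
  exact: leqnSn.
apply: le_limn_einf_near.
have near_all : \forall l \near \oo, forall i, exists j, [/\ (j < grid_size l)%N,
    q i l j <= x i ord0 < q i l j.+1 & th * f i (x i ord0) <= a i l j].
  by apply: filter_forall => i; exact: near_x.
near=> l.
have xl : forall i, exists j, [/\ (j < grid_size l)%N,
    q i l j <= x i ord0 < q i l j.+1 & th * f i (x i ord0) <= a i l j].
  by near: l.
rewrite /g -EFinM lee_fin mulrCA ler_wpM2l//.
apply: (@le_trans _ _ (\prod_i (th * f i (x i ord0)))).
  rewrite big_split/= prodr_const card_ord ler_wpM2r//.
  exact: prodr_ge0.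
apply: ler_prod => i _; rewrite mulr_ge0 ?f0 ?expR_ge0//=.
have [j [jN xj aj]] := xl i.
rewrite /step_fun (bigD1 (Ordinal jN))//= indicE mem_set/=; last first.
  by rewrite in_itv.
rewrite mulr1 (le_trans aj)// lerDl; apply: sumr_ge0 => k _.
by rewrite mulr_ge0// ltW.
Unshelve. all: by end_near. Qed.

End bound.
End product_density.

(** * Bounded densities *)

Section bounded_density.
Local Open Scope ereal_scope.
Context {dT : measure_display} {T : measurableType dT} {R : realType}.
Variables (mu : {sigma_finite_measure set T -> \bar R})
  (nu : {finite_measure set T -> \bar R}) (M : R).
Hypothesis M0 : (0 <= M)%R.
Hypothesis nu_le : forall A, measurable A -> nu A <= M%:E * mu A.

(** The domination gives absolute continuity, hence a Radon-Nikodym density f. On the set D where f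
    >= M + 1/(k+1), one has (M + 1/(k+1)) mu D <= nu D <= M mu D, which forces mu D = 0. *)
Lemma has_density_bounded_by_le : has_density_bounded_by nu mu M.
Proof.
have nu_mu : nu `<< mu.
  apply/null_content_dominatesP => A mA muA0; apply/eqP.
  by rewrite eq_le measure_ge0 andbT (le_trans (nu_le mA))// muA0 mule0.
have [f [f0 ffin intf nuE]] := radon_nikodym_sigma_finite nu_mu.
have mf : measurable_fun setT f by case/integrableP: intf.
exists (fine \o f); split.
  split; first exact/measurableT_comp.
    by move=> x; exact: fine_ge0.
  by move=> A mA; rewrite nuE//; apply: eq_integral => x _; rewrite /= fineK.
pose D (k : nat) := [set x | (M + k.+1%:R^-1)%:E <= f x].
have mD k : measurable (D k).
  by rewrite -[D k]setTI; exact: emeasurable_fun_c_infty.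
have muD k : mu (D k) = 0.
  have Mk0 : (0 < M + k.+1%:R^-1)%R by rewrite ltr_wpDl.
  have le1 : (M + k.+1%:R^-1)%:E * mu (D k) <= nu (D k).
    rewrite nuE// -integral_cst//; apply: ge0_le_integral => //.
    - by move=> x _; rewrite lee_fin ltW.
    - exact: measurable_funTS.
  (* Finiteness of [mu (D k)], which comes from that of [nu], is what allows M mu D to be
     cancelled. *)
  have fin : mu (D k) \is a fin_num.
    rewrite ge0_fin_numE// ltNge leye_eq; apply/negP => /eqP muoo.
    move: le1; rewrite muoo gt0_muley ?lte_fin// leye_eq => /eqP nuoo.
    have : nu (D k) \is a fin_num by exact: fin_num_measure.
    by rewrite nuoo.
  have le2 : (M + k.+1%:R^-1)%:E * mu (D k) <= M%:E * mu (D k).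
    exact: le_trans le1 (nu_le (mD k)).
  have mu0 : 0 <= mu (D k) by exact: measure_ge0.
  move: fin mu0 le2; case: (mu (D k)) => //= r _.
  rewrite -!EFinM !lee_fin => r0; rewrite mulrDl gerDl.
  rewrite pmulr_rle0 ?invr_gt0// => r0'.
  by congr (_%:E); apply/eqP; rewrite eq_le r0 r0'.
have : mu.-negligible (\bigcup_k D k).
  apply: negligible_bigcup => k; exists (D k).
  by split; [exact: mD|exact: muD|].
move=> [N [mN N0 DN]]; exists N; split => // x /= /negP; rewrite -ltNge => Mf.
apply: DN; have [k Mk] := ltr_add_invr Mf.
by exists k => //; rewrite /D/= -[f x]fineK// lee_fin ltW.
Qed.

End bounded_density.

Section truncated_density.
Context {R : realType}.
Local Notation Rm := (measurableTypeR R).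
Local Notation mu := (@lebesgue_measure R).
Context {dT : measure_display} {T : measurableType dT} (Pr : probability T R).
Variables (X : {RV Pr >-> R}) (K : R).
Hypothesis dX : has_density_bounded_by (distribution Pr X) mu K.

(** The transport needs the bound at every point, so f is replaced by min (f, K), equal to it almost
    everywhere. If K <= 0, the density would vanish almost everywhere and have mass 0. *)
Lemma pointwise_bounded_density : 0 < K /\ exists f : R -> R,
  [/\ is_density (distribution Pr X) mu f, prob_density f &
      forall x, f x <= K].
Proof.
have [f [[mf f0 fE] [N [mN N0 fN]]]] := dX.
have mN' : @measurable _ Rm N by exact: mN.
have mf' : measurable_fun setT (f : Rm -> R) by [].
have intE (g : R -> R) (D : set R) : measurable_fun setT (g : Rm -> R) ->
    (forall x, 0 <= g x) -> measurable D ->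
    (@integral _ R R mu D (fun x => (g x)%:E) =
     @integral _ Rm R mu D (fun x => (g x)%:E))%E.
  move=> mg g0 mD; apply: integral_measurableTypeR => //.
    by apply: measurable_funTS; exact/measurable_EFinP.
  by move=> x _; rewrite lee_fin.
have f1 : (\int[mu]_x (f x)%:E = 1)%E.
  by rewrite -(intE f setT)// -fE// probability_setT.
have K0 : 0 < K.
  rewrite ltNge; apply/negP => K0; have /eqP := f1.
  have mfE : measurable_fun [set: Rm] (EFin \o f) by exact/measurable_EFinP.
  have f0E (x : Rm) : [set: Rm] x -> (0 <= (EFin \o f) x)%E by rewrite lee_fin.
  rewrite (ge0_negligible_integral mN' measurableT mfE f0E N0).
  rewrite integral0_eq ?eqe ?(eq_sym 0%R) ?oner_eq0// => x [_ Nx].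
  congr (_%:E); apply/eqP; rewrite eq_le f0 andbT (le_trans _ K0)//.
  by apply: contrapT => fx; apply: Nx; apply: fN.
split => //; pose g x := Num.min (f x) K.
have mg : measurable_fun setT (g : Rm -> R) by apply: measurable_minr.
have g0 x : 0 <= g x by rewrite le_min f0 ltW.
have fg (D : set Rm) : measurable D ->
    (\int[mu]_(x in D) (f x)%:E = \int[mu]_(x in D) (g x)%:E)%E.
  move=> mD; apply: ge0_ae_eq_integral => //.
  - by apply: measurable_funTS; exact/measurable_EFinP.
  - by apply: measurable_funTS; exact/measurable_EFinP.
  - by move=> x _; rewrite lee_fin.
  - by move=> x _; rewrite lee_fin.
  - exists N; split => // x /= Dx; apply: fN => /= fx; apply: Dx => _.
    by congr (_%:E); apply/esym/min_idPl.
exists g; split.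
- split => // A mA; rewrite fE// intE// fg// intE//.
- by split => //; rewrite -fg.
- by move=> x; rewrite ge_min lexx orbT.
Qed.

End truncated_density.

(** * The projected random vector *)

Section orthonormal_completion.
Context {R : realType}.

Definition basis_mx n d (b : d.-tuple 'cV[R]_n) : 'M[R]_(d, n) :=
  \matrix_(k, i) tnth b k i 0.

Lemma basis_mx_mulE n d (b : d.-tuple 'cV[R]_n) x k :
  (basis_mx b *m x) k 0 = dotv (tnth b k) x.
Proof. by rewrite mxE; apply: eq_bigr => i _; rewrite mxE. Qed.

Lemma basis_mx_gram n d (b : d.-tuple 'cV[R]_n) d' (b' : d'.-tuple 'cV[R]_n) k l :
  (basis_mx b *m (basis_mx b')^T) k l = dotv (tnth b k) (tnth b' l).
Proof. by rewrite mxE; apply: eq_bigr => i _; rewrite !mxE. Qed.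

(** The rows of H are an orthonormal basis of ker A. Since A (A^T y) = y, A is onto and the rank
    theorem gives their number. *)
Lemma orthonormal_completion n d (A : 'M[R]_(d, n)) : A *m A^T = 1%:M ->
  exists m (H : 'M[R]_(m, n)),
    [/\ n = (d + m)%N, H *m H^T = 1%:M & A *m H^T = 0].
Proof.
move=> AA; pose h := linfun (mulmx A : 'cV[R]_n -> 'cV[R]_d).
have hE x : h x = A *m x by rewrite lfunE.
have [b [bE bO]] := orthonormal_basis_exists (lker h).
exists (\dim (lker h)), (basis_mx b); split.
- have dim_cV p : \dim {: 'cV[R]_p} = p by rewrite dimvf /dim/= muln1.
  have := limg_ker_dim h fullv; rewrite capfv dim_cV addnC.
  suff -> : (h @: fullv)%VS = fullv by rewrite dim_cV.
  apply/vspaceP => y; rewrite memvf.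
  have <- : h (A^T *m y) = y by rewrite hE mulmxA AA mul1mx.
  by rewrite memv_img// memvf.
- by apply/matrixP => k l; rewrite basis_mx_gram bO mxE.
- apply/matrixP => k l; rewrite [RHS]mxE.
  have : tnth b l \in lker h by apply: (basis_mem bE); exact: mem_tnth.
  rewrite memv_ker hE => /eqP /matrixP /(_ k 0); rewrite [X in _ = X -> _]mxE => <-.
  by rewrite !mxE; apply: eq_bigr => i _; rewrite !mxE.
Qed.

End orthonormal_completion.

Section projection.
Context {R : realType} (n : nat).
Local Notation Rm := (measurableTypeR R).
Variables (E : {vspace 'cV[R]_n}) (P : 'M[R]_n) (b : (\dim E).-tuple 'cV[R]_n).
Hypotheses (PE : orthogonal_projection E P) (bE : orthonormal_basis b).

Definition combine (y : 'cV[R]_(\dim E)) : 'cV[R]_n :=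
  \sum_(k < \dim E) y k 0 *: tnth b k.

(** x and P x have the same inner products with E, so the coordinates of P x in the basis are those
    of A x, for A = [basis_mx b]. *)
Lemma projection_combine x : P *m x = combine (basis_mx b *m x).
Proof.
have [PxE Px0] := PE x; have [b1 b2] := bE.
have bkE k : tnth b k \in E by apply: (basis_mem b1); exact: mem_tnth.
rewrite /combine [LHS](coord_basis b1 PxE); apply: eq_bigr => k _.
rewrite -tnth_nth; congr (_ *: _); rewrite basis_mx_mulE dotvC.
have := Px0 _ (bkE k).
rewrite dotvDl -scaleN1r dotvZl mulN1r => /eqP; rewrite subr_eq0 => /eqP ->.
rewrite [in RHS](coord_basis b1 PxE).
have dot_sum (c : 'I_(\dim E) -> R) :
    dotv (\sum_i c i *: b`_i) (tnth b k) = c k.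
  rewrite /dotv; under eq_bigr do rewrite summxE mulr_suml.
  rewrite exchange_big/=.
  transitivity (\sum_i c i * dotv (tnth b i) (tnth b k)).
    apply: eq_bigr => i _; rewrite mulr_sumr; apply: eq_bigr => j _.
    by rewrite mxE -tnth_nth mulrA.
  rewrite (bigD1 k)//= b2 eqxx mulr1 big1 ?addr0// => i /negPf ik.
  by rewrite b2 ik mulr0.
by rewrite dot_sum.
Qed.

Lemma measurable_combine : measurable_fun setT combine.
Proof.
apply/measurable_fun_matrixP => i j; under eq_fun do rewrite summxE.
apply: measurable_sum => k; under eq_fun do rewrite mxE.
by apply: measurable_funM => //; exact: measurable_fun_entry.
Qed.

Lemma basis_mx_orthonormal : basis_mx b *m (basis_mx b)^T = 1%:M.
Proof.
by apply/matrixP => k l; rewrite basis_mx_gram; case: bE => _ ->; rewrite mxE.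
Qed.

Lemma lebesgue_subspaceE (B : set 'cV[R]_n) :
  lebesgue_subspace b B = leb (\dim E) (combine @^-1` B).
Proof.
rewrite /lebesgue_subspace /leb /pushforward -comp_preimage.
have -> // : from_coords b = combine \o @colt R (\dim E).
by apply: funext => t; apply: eq_bigr => k _; rewrite mxE.
Qed.

(** Sets of finite measure exhausting the coordinate space are pulled back along [coords], a left
    inverse of [from_coords b]. The Radon-Nikodym theorem is applied to this measure. *)
Lemma lebesgue_subspace_sigma_finite : sigma_finite setT (lebesgue_subspace b).
Proof.
have [F FT Foo] := sigma_finiteT (@lebesgue_tuple R (\dim E)).
pose coords (x : 'cV[R]_n) : (\dim E).-tuple Rm := [tuple dotv x (tnth b k) | k < \dim E].
have mcoords : measurable_fun setT coords.
  apply/measurable_fun_tnthP => k.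
  rewrite (_ : _ \o _ =
    (fun x : 'cV[R]_n => \sum_i x i 0 * tnth b k i 0)); last first.
    by apply/funext => x /=; rewrite tnth_mktuple.
  by apply: measurable_sum => i; apply: measurable_funM => //; exact: measurable_fun_entry.
have coordsK t : coords (from_coords b t) = t.
  apply: eq_from_tnth => k; rewrite tnth_mktuple /from_coords /dotv.
  under eq_bigr do rewrite summxE mulr_suml.
  rewrite exchange_big/=.
  transitivity (\sum_i tnth t i * dotv (tnth b i) (tnth b k)).
    apply: eq_bigr => i _; rewrite mulr_sumr; apply: eq_bigr => j _.
    by rewrite mxE mulrA.
  rewrite (bigD1 k)//=; case: bE => _ b2; rewrite b2 eqxx mulr1.
  by rewrite big1 ?addr0// => i /negPf ik; rewrite b2 ik mulr0.
exists (fun k => coords @^-1` F k).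
  apply/esym; rewrite -subTset => x _.
  have [i _ Fi] : (\bigcup_i F i) (coords x) by rewrite -FT.
  by exists i.
move=> k; have [mF Fk] := Foo k; split.
  by rewrite -[X in measurable X]setTI; exact: mcoords.
rewrite /lebesgue_subspace /pushforward -comp_preimage.
by rewrite (_ : _ \o _ = id) ?preimage_id//; exact/funext.
Qed.

End projection.

Lemma product_density_bound {R : realType} (n d : nat) (A : 'M[R]_(d, n))
    (f : 'I_n -> R -> R) (K : R) (B : set 'cV[R]_d) : A *m A^T = 1%:M ->
  (forall i, prob_density (f i)) -> (forall i x, f i x <= K) -> 0 < K ->
  measurable B ->
  (\int[leb n]_x (\1_B (A *m x) * \prod_i f i (x i ord0))%:E <=
   ((expR 1 * K) ^+ d)%:E * leb d B)%E.
Proof.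
move=> AA df fK K0 mB; have [m [H [nE HH AH]]] := orthonormal_completion AA.
by subst n; exact: (product_density_bound_frame AA HH AH).
Qed.

Theorem theorem1p1 (R : realType) :
  exists C : R, 0 < C /\
    forall (dT : measure_display) (T : measurableType dT)
      (Pr : probability T R) (n d : nat)
      (X : 'I_n -> {RV Pr >-> R}) (K : R)
      (E : {vspace 'cV[R]_n}) (P : 'M[R]_n),
      independent_RVs X ->
      (forall i, has_density_bounded_by
                   (distribution Pr (X i)) lebesgue_measure K) ->
      \dim E = d ->
      orthogonal_projection E P ->
      forall b : (\dim E).-tuple 'cV[R]_n,
        orthonormal_basis b ->
        has_density_bounded_by
          (distribution Pr (projected P X)) (lebesgue_subspace b)
          ((C * K) ^+ d).
Proof.
exists (expR 1); split; first exact: expR_gt0.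
move=> dT T Pr n d X K E P indX dX <- PE b bE.
(* For n = 0 no coordinate forces K > 0, but then \dim E = 0 and both powers are 1, so K' = 1 will
   do. *)
have [K' [K'0 K'X K'E]] : exists K', [/\ 0 < K',
    forall i, has_density_bounded_by (distribution Pr (X i)) lebesgue_measure K' &
    (expR 1 * K') ^+ \dim E = (expR 1 * K) ^+ \dim E].
  case: n => [|n] in X E P indX dX PE b bE *; last first.
    by exists K; split => //; have [] := pointwise_bounded_density (dX ord0).
  exists 1; split => // [[]//|].
  have -> : \dim E = 0%N; last by rewrite !expr0.
  by apply/eqP; rewrite -leqn0 (leq_trans (dimvS (subvf E)))// dimvf /dim/= mul0n.
have [f fP] := choice (fun i => (pointwise_bounded_density (K'X i)).2).
have df i : is_density (distribution Pr (X i)) lebesgue_measure (f i).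
  by have [] := fP i.
rewrite -{}K'E; pose pack := Measure_isSigmaFinite.Build _ _ _
  (lebesgue_subspace b) (lebesgue_subspace_sigma_finite bE).
pose mu : {sigma_finite_measure set 'cV[R]_n -> \bar R} :=
  HB.pack (lebesgue_subspace b) pack.
apply: (@has_density_bounded_by_le _ _ _ mu).
  by rewrite exprn_ge0// mulr_ge0 ?expR_ge0// ltW.
move=> B mB; rewrite /= lebesgue_subspaceE.
have mcB : measurable (combine b @^-1` B).
  by rewrite -[X in measurable X]setTI; exact: measurable_combine.
have mPB : measurable ((fun x : 'cV[R]_n => P *m x) @^-1` B).
  by rewrite -[X in measurable X]setTI; exact: measurable_mulmx.
have -> : distribution Pr (projected P X) B =
    (\int[leb n]_(x in (fun x => P *m x) @^-1` B)
      (\prod_i f i (x i ord0))%:E)%E.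
  by rewrite -(law_density indX df mPB).
have pf i : prob_density (f i) by have [] := fP i.
have fK i x : f i x <= K' by have [_ _] := fP i; apply.
apply: le_trans (product_density_bound (basis_mx_orthonormal bE) pf fK K'0 mcB).
(* P x lies in B exactly when A x lies in the preimage of B under [combine b], so the two integrands
   coincide. *)
rewrite integral_mkcond le_eqVlt; apply/orP; left; apply/eqP.
apply: eq_integral => x _; rewrite /patch; case: ifPn.
  rewrite inE/= => xB; rewrite indicE mem_set ?mul1r//=.
  by rewrite -(projection_combine PE bE).
rewrite notin_setE/= => xB; rewrite indicE memNset ?mul0r//=.
by rewrite -(projection_combine PE bE).
Qed.
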